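(* Let $G$ be a cubic graph with $V$ vertices, and let $F_G(Q)$ be its flow polynomial. Then the integer $F_G(0)$ satisfies $$F_G(0)\equiv 0,\,1,\text{ or }4 \pmod 5\quad\text{if } V/2 \text{ is even},$$ $$F_G(0)\equiv 0,\,2,\text{ or }3 \pmod 5\quad\text{if } V/2 \text{ is odd}.$$ Moreover, if $G$ is a snark, that is, a bridgeless cubic graph with chromatic index $4$, then $F_G(0)\equiv 0 \pmod 5$, and therefore $F_G(0)$ is divisible by $120$.
   Context: Graphs are finite; loops and multiple edges are allowed. A cubic graph is a graph all of whose vertices have degree $3$ (a loop contributes $2$ to the degree), so $V$ is even. The chromatic index is the minimum number of colors in a proper edge coloring. The flow polynomial $F_G(Q)\in\mathbb{Z}[Q]$ is determined by: $F_G=F_{G/e}-F_{G\smallsetminus e}$ for every edge $e$ that is neither a loop nor a bridge; $F_G=0$ if $G$ has a bridge; the value on one vertex with $n$ loops is $(Q-1)^n$; and multiplicativity under disjoint union. Equivalently $F_G(Q)=\sum_{A\subseteq E(G)}(-1)^{|E(G)|-|A|}Q^{|A|-|V(G)|+c(A)}$, where $c(A)$ is the number of connected components of the spanning subgraph $(V(G),A)$. For a positive integer $n$, $F_G(n)$ is the number of nowhere-zero flows on $G$ with values in an abelian group of order $n$. *)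

(* Defs.v *)
From HB Require Import structures.
From mathcomp Require Import all_boot all_order all_algebra.

Set Implicit Arguments.
Unset Strict Implicit.
Unset Printing Implicit Defensive.

Import GRing.Theory.
Local Open Scope ring_scope.

(* Finite graphs with loops and multiple edges.  The pair [ends e] stands for
   an unordered pair: all notions below are invariant under swapping it. *)
Record multigraph := Multigraph {
  vert : finType;
  edge : finType;
  ends : edge -> vert * vert
}.

Section Multigraph.
Variable G : multigraph.
Implicit Types (v : vert G) (e : edge G) (A : {set edge G}).

Definition incident e v : bool := ((ends e).1 == v) || ((ends e).2 == v).

(* A loop at v contributes 2. *)
Definition degree v : nat :=
  (\sum_(e : edge G) (((ends e).1 == v) + ((ends e).2 == v)))%N.

Definition cubic : Prop := forall v, degree v = 3%N.

Definition adjacent A : rel (vert G) :=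
  fun u v => [exists e in A, (ends e == (u, v)) || (ends e == (v, u))].

Definition ncomps A : nat := n_comp (adjacent A) (vert G).

Definition bridge e : bool := (ncomps [set: edge G] < ncomps [set~ e])%N.

Definition bridgeless : Prop := forall e, ~~ bridge e.

(* The natural-number subtractions never truncate: the forest bound gives
   #|vert G| <= #|A| + ncomps A. *)
Definition flow_poly : {poly int} :=
  \sum_(A : {set edge G})
    (-1) ^+ (#|edge G| - #|A|) * 'X^(#|A| + ncomps A - #|vert G|).

(* Only distinct edges are compared, so a loop imposes no condition on its own
   colour. *)
Definition proper_edge_coloring k (f : {ffun edge G -> 'I_k}) : bool :=
  [forall e1, forall e2, (e1 != e2) ==>
     [exists v, incident e1 v && incident e2 v] ==> (f e1 != f e2)].

Definition edge_colorable k : bool :=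
  [exists f : {ffun edge G -> 'I_k}, proper_edge_coloring f].

Lemma edge_colorable_exists : exists k, edge_colorable k.
Proof.
exists #|edge G|; apply/existsP; exists [ffun e => enum_rank e].
apply/forallP => e1; apply/forallP => e2; apply/implyP => ne12.
by apply/implyP => _; rewrite !ffunE (inj_eq enum_rank_inj).
Qed.

Definition chromatic_index : nat := ex_minn edge_colorable_exists.

Definition snark : Prop := [/\ cubic, bridgeless & chromatic_index = 4%N].

End Multigraph.

(* Main.v *)
Require Import Defs.
From HB Require Import structures.
From mathcomp Require Import all_boot all_order all_algebra.
From mathcomp Require Import ring zify finalg finfield mxabelem.

Set Implicit Arguments.
Unset Strict Implicit.
Unset Printing Implicit Defensive.

Import GRing.Theory.
Local Open Scope ring_scope.

(** Since 5 = 0 in F_5, the residue of F_G(0) is that of F_G(5), hence that of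
    the number N(G) of nowhere-zero F_5-flows.  Everything modulo 5 follows from
    an identity in F_5, valid for every cubic graph, planar or not:
      N(G) = 2^(V/2) T(G)^2,
    where T(G) is the signed count of 3-edge-colourings: the sum, over all
    labellings of the edges by three colours, of the product over the vertices
    of the Levi-Civita symbol of the three labels around the vertex.  The cyclic
    orders chosen at the vertices affect only the sign of T.  Squares in F_5 are
    0, 1 and 4, and 2^k is 1 or -1 for even k, 2 or -2 for odd k; and T(G) = 0 if
    G has no proper 3-edge-colouring.

    The identity ([gap_eq0]) is proved by comparing both sides under a
    rearrangement around an edge e = uv, where u carries the half-edges e, a, b
    and v carries e, c, d.  On the flow side, N(G) = N(G/e) - N(G \ e), and the
    four-valent vertex of G/e is symmetric in a, b, c, d
    ([nflow_contract_delete]).  On the colouring side, let p, q, r be the values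
    of T when u, v, e are removed and a, b, c, d are joined in pairs as ab|cd,
    ac|bd, ad|bc.  Contracting two Levi-Civita symbols gives T(G) = q - r
    ([tait_ihx]), and T(G \ e) = p.  Moreover p + q + r = 0 in F_5
    ([tait_pairings]): the rest of the network is an so(3)-invariant quartic
    tensor on a space of dimension 3, its symmetrization is c |x|^4, and the full
    contraction of that with the metric is 15 c = 0.  Hence 2 (q - r)^2 + p^2 =
    - (p^2 + q^2 + r^2) is also symmetric in a, b, c, d.  So, once the identity
    is known for simpler graphs, the difference of the two sides does not change
    when half-edges are exchanged across an edge ([gap_exchange]).  Such
    exchanges shorten any cycle until it is a loop at a cubic vertex
    ([gap_cycle]), and then both sides vanish.

    For divisibility by 24, a snark has F_G(1) = F_G(2) = F_G(3) = F_G(4) = 0, so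
    the polynomial (Q - 1)(Q - 2)(Q - 3)(Q - 4) divides F_G over the integers and
    24 divides F_G(0).  Indeed F_G(q) counts nowhere-zero flows with values in a
    field of q elements ([flow_poly_count]); odd degrees exclude flows over F_2,
    a flow over F_4 is a 3-edge-colouring, and a flow over F_3 orients G as a
    regular bipartite graph, which is 3-edge-colourable by König's theorem
    ([koenig]). *)

(** * Changing one value of a finite function *)
Section Update.
Variables (I S : finType).
Implicit Types (f : {ffun I -> S}) (i : I) (t : S).

Definition upd f i t : {ffun I -> S} := [ffun j => if j == i then t else f j].

Lemma updE f i t : upd f i t i = t.
Proof. by rewrite ffunE eqxx. Qed.

Lemma updN f i t j : j != i -> upd f i t j = f j.
Proof. by rewrite ffunE => /negPf ->. Qed.

Lemma upd_upd f i t t' : upd (upd f i t) i t' = upd f i t'.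
Proof. by apply/ffunP => j; rewrite !ffunE; case: eqP. Qed.

Lemma upd_id f i : upd f i (f i) = f.
Proof. by apply/ffunP => j; rewrite !ffunE; case: eqP => // ->. Qed.

Lemma map_upd f i t (s : seq I) : i \notin s -> map (upd f i t) s = map f s.
Proof.
move=> si; apply/eq_in_map => j sj; rewrite updN //.
by apply: contraNneq si => <-.
Qed.

(** This isolates one coordinate of a sum over all functions; [t0] is a dummy
    value held by that coordinate in the outer sum. *)
Lemma sum_upd (V : nmodType) i (t0 : S) (F : {ffun I -> S} -> V) :
  \sum_(f : {ffun I -> S}) F f =
  \sum_(f : {ffun I -> S} | f i == t0) \sum_t F (upd f i t).
Proof.
rewrite (partition_big (fun f => upd f i t0) (fun f => f i == t0)) /=;
  last by move=> f _; rewrite updE.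
apply: eq_bigr => f /eqP fi; rewrite (reindex_onto (upd f i) (fun g => g i)) /=.
  apply: eq_bigl => t; rewrite upd_upd updE eqxx andbT.
  by rewrite -fi upd_id eqxx.
by move=> g /eqP <-; rewrite upd_upd upd_id.
Qed.

End Update.

(** * Flows and signed colourings of lists of half-edges *)
Section Networks.
Variable E : finType.
Notation dart := (E * bool)%type.
Implicit Types (e : E) (d : dart) (l s : seq dart) (gs r : seq (seq dart)).

(** A graph on the edge set [E] is a list of vertices, each vertex being the list
    of its half-edges.  The half-edges of [e] are [(e, true)] and [(e, false)];
    the boolean gives [e] a direction.  The order inside a vertex only affects
    signs. *)
Definition flip d : dart := (d.1, ~~ d.2).

Definition excess (K : pzRingType) (x : {ffun E -> K}) l : K :=
  \sum_(d <- l) (-1) ^+ d.2 * x d.1.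

(** The Levi-Civita symbol, as a Vandermonde product divided by 2 = 3^-1. *)
Definition eps (i j k : 'I_3) : 'F_5 :=
  3%:R * (j%:R - i%:R) * (k%:R - i%:R) * (k%:R - j%:R).

(** Vertices of degree 2 carry the metric, so they act as subdivisions of an
    edge and a vertex [:: d; flip d] is a free circle.  Such vertices appear when
    an edge of a cubic graph is deleted. *)
Definition wt (s : seq 'I_3) : 'F_5 :=
  match s with
  | [::] => 1
  | [:: i; j] => (i == j)%:R
  | [:: i; j; k] => eps i j k
  | _ => 0
  end.

Definition wts gs (c : dart -> 'I_3) : 'F_5 := \prod_(l <- gs) wt (map c l).

(** Every edge of [E] takes part, in [nflow] as in [tait]: a deleted or contracted
    edge is kept as a free circle, which multiplies the first by 4 = -1 and the
    second by 3, so that it multiplies both sides of the identity by -1. *)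
Definition nflow gs : 'F_5 :=
  \sum_(x : {ffun E -> 'F_5})
    (\prod_e (x e != 0)%:R) * \prod_(l <- gs) (excess x l == 0)%:R.

(** The Penrose sum of signed 3-edge-colourings. *)
Definition tait gs : 'F_5 := \sum_(c : {ffun E -> 'I_3}) wts gs (c \o fst).

Lemma excess_cons (K : pzRingType) (x : {ffun E -> K}) d l :
  excess x (d :: l) = (-1) ^+ d.2 * x d.1 + excess x l.
Proof. by rewrite /excess big_cons. Qed.

Lemma excess_cat (K : pzRingType) (x : {ffun E -> K}) l s :
  excess x (l ++ s) = excess x l + excess x s.
Proof. by rewrite /excess big_cat. Qed.

Lemma excess_perm (K : pzRingType) (x : {ffun E -> K}) l s :
  perm_eq l s -> excess x l = excess x s.
Proof. by move=> ls; apply: perm_big. Qed.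

Lemma excess_upd (K : finPzRingType) (x : {ffun E -> K}) e t l :
  (forall d, d \in l -> d.1 != e) -> excess (upd x e t) l = excess x l.
Proof. by move=> le; apply: eq_big_seq => d dl; rewrite updN ?le. Qed.

Lemma sum_nz_F5 : \sum_(t : 'F_5) (t != 0)%:R = -1 :> 'F_5.
Proof.
rewrite (bigD1 0) //= ?mulr0n add0r (eq_bigr (fun=> 1)) => [|t ->] //.
rewrite sumr_const cardC1 card_Fp //; exact/eqP.
Qed.

(** The value on the edge is forced by the conservation law at either end; it is
    nonzero exactly when one end does not balance by itself. *)
Lemma sum_transfer (b : bool) (u v : 'F_5) :
  \sum_(y : 'F_5) [&& y != 0, (-1) ^+ b * y + u == 0 &
       (-1) ^+ (~~ b) * y + v == 0]%:R = ((u + v == 0) && (u != 0))%:R :> 'F_5.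
Proof.
have bb : (-1) ^+ b * (-1) ^+ b = 1 :> 'F_5 by rewrite -signr_addb addbb.
have bN : (-1) ^+ (~~ b) = - (-1) ^+ b :> 'F_5.
  by case: b {bb}; rewrite /= ?expr0 ?expr1 ?opprK.
rewrite (bigD1 (- ((-1) ^+ b * u))) // big1 => [|y ne] /=.
  rewrite addr0 bN !mulrN mulNr opprK mulrA bb mul1r addNr eqxx /=.
  by rewrite oppr_eq0 mulf_eq0 signr_eq0 andbC.
case: (eqVneq y 0) => //= _; case: eqP => //= yu; case/eqP: ne.
move/eqP: yu; rewrite addrC addr_eq0 => /eqP ->.
by rewrite mulrN mulrA bb mul1r opprK.
Qed.

Definition off e s := all (fun d => d.1 != e) s.

(** Contraction and deletion: given values on the other edges, the value on the
    edge of [d] is determined as soon as the contracted vertex balances, and it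
    is zero exactly when both ends balance separately.  The factor -1 of the free
    circle exchanges the two signs of the usual rule. *)
Lemma nflow_contract_delete d s t r :
    off d.1 s -> off d.1 t -> off d.1 (flatten r) ->
  nflow ((d :: s) :: (flip d :: t) :: r) =
  nflow (s :: t :: [:: d; flip d] :: r) - nflow
    ((s ++ t) :: [:: d; flip d] :: r).
Proof.
case: d => e b; rewrite /flip /= => /allP es /allP et /allP er.
rewrite /nflow !(sum_upd e 0) -sumrB; apply: eq_bigr => x /eqP xe.
set N := \prod_(e' | e' != e) (x e' != 0)%:R : 'F_5.
set Q := \prod_(l <- r) (excess x l == 0)%:R : 'F_5.
have NE y : \prod_e' (upd x e y e' != 0)%:R = (y != 0)%:R * N.
  rewrite (bigD1 e) //= updE; congr (_ * _); apply: eq_bigr => e' ne.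
  by rewrite updN.
have QE y : \prod_(l <- r) (excess (upd x e y) l == 0)%:R = Q.
  apply: eq_big_seq => l lr; rewrite excess_upd // => d dl; apply: er.
  by apply/flattenP; exists l.
under eq_bigr => y _.
  rewrite NE !big_cons QE !excess_cons /= !updE !excess_upd //.
  over.
rewrite /=; under [X in _ = X - _]eq_bigr => y _.
  rewrite NE !big_cons QE !excess_cons /= !updE !excess_upd //.
  over.
under [X in _ = _ - X]eq_bigr => y _.
  rewrite NE !big_cons QE excess_cat !excess_cons /= !updE !excess_upd //.
  over.
move: (excess x s) (excess x t) => u v.
have -> : \sum_(y : 'F_5) (y != 0)%:R * N * (((-1) ^+ b * y + u == 0)%:R *
      (((-1) ^+ (~~ b) * y + v == 0)%:R * Q)) =
   N * Q * \sum_(y : 'F_5) [&& y != 0, (-1) ^+ b * y + u == 0 &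
       (-1) ^+ (~~ b) * y + v == 0]%:R.
  rewrite mulr_sumr; apply: eq_bigr => y _.
  by do 3! [case: eqP => _ /=]; rewrite ?(mul0r, mulr0, mul1r, mulr1).
have circ y : (-1) ^+ b * y + ((-1) ^+ (~~ b) * y + excess x [::]) = 0.
  by rewrite /excess big_nil; case: b; rewrite /= ?expr0 ?expr1; ring.
have -> : \sum_(y : 'F_5) (y != 0)%:R * N * ((u == 0)%:R * ((v == 0)%:R *
      (((-1) ^+ b * y + ((-1) ^+ (~~ b) * y + excess x [::]) == 0)%:R * Q))) =
   N * Q * ((u == 0) && (v == 0))%:R * \sum_(y : 'F_5) (y != 0)%:R.
  rewrite mulr_sumr; apply: eq_bigr => y _; rewrite circ eqxx mul1r.
  by do 3! [case: eqP => _ /=]; rewrite ?(mul0r, mulr0, mul1r, mulr1).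
have -> : \sum_(y : 'F_5) (y != 0)%:R * N * ((u + v == 0)%:R *
      (((-1) ^+ b * y + ((-1) ^+ (~~ b) * y + excess x [::]) == 0)%:R * Q)) =
   N * Q * (u + v == 0)%:R * \sum_(y : 'F_5) (y != 0)%:R.
  rewrite mulr_sumr; apply: eq_bigr => y _; rewrite circ eqxx mul1r.
  by do 2! [case: eqP => _ /=]; rewrite ?(mul0r, mulr0, mul1r, mulr1).
rewrite -!mulrA -!mulrBr -mulrBl; congr (_ * (_ * _)).
rewrite sum_nz_F5 sum_transfer.
case: (eqVneq u 0) => [->|u0] /=; rewrite ?add0r ?andbT ?andbF /=.
  by case: eqP => _ /=; rewrite ?mulr1n ?mulr0n; ring.
by rewrite ?mulr0n; case: eqP => _ /=; rewrite ?mulr1n ?mulr0n; ring.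
Qed.


Lemma nat5_F5 : 5%:R = 0 :> 'F_5.
Proof. exact/eqP. Qed.

Lemma double_triple_F5 (a : 'F_5) : a = 2%:R * (a *+ 3).
Proof.
have gen (R : comPzRingType) (x : R) : 2%:R * (x *+ 3) = x + 5%:R * x by ring.
by rewrite gen nat5_F5 mul0r addr0.
Qed.

(** An explicit enumeration of the colours, on which closed identities can be
    evaluated. *)
Definition ord3s : seq 'I_3 :=
  [:: @Ordinal 3 0 isT; @Ordinal 3 1 isT; @Ordinal 3 2 isT].

Lemma all_ord3 (p : pred 'I_3) : all p ord3s -> forall i, p i.
Proof.
move=> /allP po i; apply: po; rewrite !inE -!val_eqE /=.
by case: i => [[|[|[|i]]] lti].
Qed.

Lemma sum_ord3 (F : 'I_3 -> 'F_5) : \sum_i F i = \sum_(i <- ord3s) F i.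
Proof.
rewrite /ord3s !big_cons big_nil !big_ord_recl big_ord0.
by congr (F _ + (F _ + (F _ + _))); apply: val_inj.
Qed.

Lemma eps_eps (i j k l : 'I_3) :
  \sum_t eps t i j * eps t k l =
  ((i == k) && (j == l))%:R - ((i == l) && (j == k))%:R.
Proof.
rewrite sum_ord3 /ord3s !big_cons big_nil; apply/eqP; move: l; apply: all_ord3.
move: k; apply: all_ord3; move: j; apply: all_ord3; move: i; apply: all_ord3.
by vm_compute.
Qed.

Lemma map_comp_upd (S : finType) (x : {ffun E -> S}) e t s :
  off e s -> map (upd x e t \o fst) s = map (x \o fst) s.
Proof.
move=> /allP es; apply/eq_in_map => d ds /=; rewrite updN //; exact: es.
Qed.

Lemma off_in e r l : off e (flatten r) -> l \in r -> off e l.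
Proof.
by move=> /allP er lr; apply/allP => d dl; apply: er; apply/flattenP; exists l.
Qed.

Lemma wts_upd (x : {ffun E -> 'I_3}) e t r :
  off e (flatten r) -> wts r (upd x e t \o fst) = wts r (x \o fst).
Proof.
move=> er; apply: eq_big_seq => l lr.
by rewrite map_comp_upd //; apply: off_in er lr.
Qed.

(** The factor 2 = 3^-1 removes the contribution of the free circle. *)
Lemma tait_ihx d0 a b c d r :
    off d0.1 [:: a; b; c; d] -> off d0.1 (flatten r) ->
  tait ([:: d0; a; b] :: [:: flip d0; c; d] :: r) =
  2%:R * (tait ([:: a; c] :: [:: b; d] :: [:: d0; flip d0] :: r)
        - tait ([:: a; d] :: [:: b; c] :: [:: d0; flip d0] :: r)).
Proof.
case: d0 => e o; rewrite /flip /= => /and5P[ae be ce de _] er.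
rewrite /tait !(sum_upd e ord0) -sumrB mulr_sumr; apply: eq_bigr => x _.
under eq_bigr => t _.
  rewrite /wts !big_cons -/(wts _ _) wts_upd //= !updE !updN //; over.
under [X in _ = _ * (X - _)]eq_bigr => t _.
  rewrite /wts !big_cons -/(wts _ _) wts_upd //= !updE !updN // eqxx; over.
under [X in _ = _ * (_ - X)]eq_bigr => t _.
  rewrite /wts !big_cons -/(wts _ _) wts_upd //= !updE !updN // eqxx; over.
rewrite /=.
under eq_bigr => t _ do rewrite mulrA.
rewrite -mulr_suml eps_eps !sumr_const card_ord mul1r !mulrA -!natrM !mulnb.
rewrite mulrBl -mulrnBl; exact: double_triple_F5.
Qed.

Lemma tait_join d0 a s r :
    off d0.1 (a :: s) -> off d0.1 (flatten r) ->
  tait ([:: d0; a] :: (flip d0 :: s) :: r) =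
  2%:R * tait ((a :: s) :: [:: d0; flip d0] :: r).
Proof.
case: d0 => e o; rewrite /flip /= => /andP[ae es] er.
rewrite /tait !(sum_upd e ord0) mulr_sumr; apply: eq_bigr => x _.
under eq_bigr => t _.
  rewrite /wts !big_cons -/(wts _ _) wts_upd //= !updE !updN //.
  rewrite map_comp_upd //; over.
under [X in _ = _ * X]eq_bigr => t _.
  rewrite /wts !big_cons -/(wts _ _) wts_upd // [[seq _ | _ <- a :: s]]/=.
  rewrite /= !updE !updN // map_comp_upd // eqxx; over.
rewrite (bigD1 (x a.1)) //= big1 => [|t /negPf ->]; last by rewrite mul0r.
rewrite sumr_const card_ord ?eqxx !mul1r addr0.
exact: double_triple_F5.
Qed.

Definition matched (c : {ffun dart -> 'I_3}) : 'F_5 :=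
  \prod_e (c (e, true) == c (e, false))%:R.

(** Labelling the two half-edges of an edge independently, and requiring them to
    agree, separates the metric on the edges from the tensors at the vertices,
    on which the rotations act. *)
Lemma tait_darts gs :
  tait gs = \sum_(c : {ffun dart -> 'I_3}) matched c * wts gs c.
Proof.
pose p (c : {ffun dart -> 'I_3}) := [forall e, c (e, true) == c (e, false)].
rewrite (bigID p) /= [X in _ + X]big1 ?addr0; last first.
  move=> c /forallPn[e ne]; rewrite /matched (bigD1 e) //= (negPf ne).
  by rewrite !mul0r.
pose h (x : {ffun E -> 'I_3}) : {ffun dart -> 'I_3} := [ffun d => x d.1].
rewrite (reindex_onto h (fun c => [ffun e => c (e, true)])) /=; last first.
  move=> c /forallP pc; apply/ffunP => -[e []]; rewrite !ffunE //.
  exact/eqP.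
rewrite /tait; apply: eq_big => [x|x _].
  have -> : p (h x) by apply/forallP => e; rewrite !ffunE.
  by symmetry; apply/eqP/ffunP => e; rewrite !ffunE.
rewrite /matched big1 ?mul1r; last by move=> e _; rewrite !ffunE eqxx.
by apply: eq_bigr => l _; congr wt; apply: eq_map => d; rewrite !ffunE.
Qed.

End Networks.

(** * Infinitesimal rotations, and the relation special to characteristic 5 *)
Section Rotations.
Variable E : finType.
Notation dart := (E * bool)%type.
Notation labels := {ffun dart -> 'I_3}.
Implicit Types (e : E) (d : dart) (l s : seq dart) (gs r : seq (seq dart)).

(** The generator of so(3) in the plane of the axes [p] and [q]. *)
Definition so3_gen (p q i j : 'I_3) : 'F_5 :=
  ((i == p) && (j == q))%:R - ((i == q) && (j == p))%:R.

Lemma so3_gen_anti p q i j : so3_gen p q i j + so3_gen p q j i = 0.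
Proof.
rewrite /so3_gen [(j == p) && _]andbC [(j == q) && _]andbC.
by rewrite addrA subrK subrr.
Qed.

(** The action of a generator on the index attached to the half-edge [d]. *)
Definition so3_act (p q : 'I_3) d (F : labels -> 'F_5) (c : labels) : 'F_5 :=
  \sum_j so3_gen p q (c d) j * F (upd c d j).

Lemma so3_act_adjoint p q d (F H : labels -> 'F_5) :
  \sum_(c : labels) F c * so3_act p q d H c =
  - \sum_(c : labels) so3_act p q d F c * H c.
Proof.
rewrite /so3_act; under eq_bigr do rewrite mulr_sumr.
under [in RHS]eq_bigr do rewrite mulr_suml.
rewrite !pair_bigA /= -sumrN.
(* Exchanging the old and the new value of the index at [d]. *)
pose swp (u : labels * 'I_3) := (upd u.1 d u.2, u.1 d).
have swpK : involutive swp.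
  by move=> [c j]; rewrite /swp /= updE upd_upd upd_id.
rewrite (reindex_inj (inv_inj swpK)) /=; apply: eq_bigr => -[c j] _ /=.
rewrite updE upd_upd upd_id.
have /eqP := so3_gen_anti p q (c d) j; rewrite addr_eq0 => /eqP ->.
by rewrite !mulNr opprK; rewrite mulrCA mulrA.
Qed.

(** The metric is invariant, because the generator is antisymmetric. *)
Lemma so3_act_matched p q e (c : labels) :
  so3_act p q (e, true) (@matched E) c +
  so3_act p q (e, false) (@matched E) c = 0.
Proof.
pose M := \prod_(e' | e' != e) (c (e', true) == c (e', false))%:R : 'F_5.
have upM o j : matched (upd c (e, o) j) = (j == c (e, ~~ o))%:R * M.
  rewrite /matched (bigD1 e) //=; congr (_ * _).
    by case: o; rewrite updE updN ?xpair_eqE ?eqxx //= eq_sym.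
  apply: eq_bigr => e' ne; rewrite !updN // xpair_eqE (negPf ne) //.
have actM o : so3_act p q (e, o) (@matched E) c =
    so3_gen p q (c (e, o)) (c (e, ~~ o)) * M.
  rewrite /so3_act (bigD1 (c (e, ~~ o))) //= upM eqxx mul1r big1 ?addr0 // =>
    j ne.
  by rewrite upM (negPf ne) mul0r mulr0.
by rewrite !actM -mulrDl /= so3_gen_anti mul0r.
Qed.

(** In a closed network the action on all half-edges cancels edge by edge, once it
    is moved from the vertices to the edges. *)
Lemma so3_act_closed p q (F : labels -> 'F_5) :
  \sum_(d : dart) \sum_(c : labels) matched c * so3_act p q d F c = 0.
Proof.
under eq_bigr do rewrite so3_act_adjoint.
rewrite sumrN exchange_big big1 ?oppr0 // => c _.
rewrite -mulr_suml (_ : \sum_i _ = 0) ?mul0r //.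
rewrite (eq_bigr (fun d => so3_act p q (d.1, d.2) (@matched E) c));
  last by case.
rewrite -(pair_bigA _ (fun e o => so3_act p q (e, o) (@matched E) c)) /=.
by rewrite big1 // => e _; rewrite big_bool /= so3_act_matched.
Qed.

(** The metric and the Levi-Civita symbol at the vertices are invariant. *)
Lemma so3_act_wt p q l (c : labels) : uniq l ->
  \sum_(d <- l) so3_act p q d (fun c' => wt (map c' l)) c = 0.
Proof.
rewrite /so3_act; case: l => [|x [|y [|z [|t l]]]] /= ul.
- by rewrite big_nil.
- by rewrite big_cons big_nil big1 ?addr0 // => j _; rewrite mulr0.
- move: ul; rewrite inE andbT => nxy; rewrite !big_cons big_nil addr0.
  under eq_bigr do rewrite updE updN 1?eq_sym //.
  under [X in _ + X]eq_bigr do rewrite updE updN //.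
  move: (c x) (c y) => i j.
  rewrite !sum_ord3 /ord3s !big_cons !big_nil; apply/eqP; move: j;
    apply: all_ord3.
  move: i; apply: all_ord3; move: q; apply: all_ord3; move: p; apply: all_ord3.
  by vm_compute.
- move: ul; rewrite !inE negb_or andbT => /andP[/andP[nxy nxz] nyz].
  rewrite !big_cons big_nil addr0.
  under eq_bigr do rewrite updE !updN 1?eq_sym //.
  under [X in _ + (X + _)]eq_bigr do rewrite updE !updN // 1?eq_sym //.
  under [X in _ + (_ + X)]eq_bigr do rewrite updE !updN //.
  move: (c x) (c y) (c z) => i j k.
  rewrite !sum_ord3 /ord3s !big_cons !big_nil; apply/eqP; move: k;
    apply: all_ord3.
  move: j; apply: all_ord3.
  move: i; apply: all_ord3; move: q; apply: all_ord3; move: p; apply: all_ord3.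
  by vm_compute.
- by apply: big1_seq => d _; apply: big1 => j _; rewrite mulr0.
Qed.

Definition indep (F : labels -> 'F_5) s :=
  forall d (c : labels) j, d \in s -> F (upd c d j) = F c.

Lemma indep_wt s l : [disjoint s & l] ->
  indep (fun c : labels => wt (map c l)) s.
Proof.
by move=> dsl d c j ds; rewrite map_upd //; rewrite (disjointFr dsl ds).
Qed.

Lemma indep_wts s r : [disjoint s & flatten r] ->
  indep (fun c : labels => wts r c) s.
Proof.
move=> dsr d c j ds; apply: eq_big_seq => l lr; rewrite map_upd //.
apply: contraFN (disjointFr dsr ds) => dl; apply/flattenP; by exists l.
Qed.

(** By the Leibniz rule, a product of invariant tensors on disjoint sets of
    half-edges is invariant. *)
Lemma so3_act_wts p q (F : labels -> 'F_5) r c :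
  uniq (flatten r) -> indep F (flatten r) ->
  \sum_(d <- flatten r) so3_act p q d (fun c' => F c' * wts r c') c = 0.
Proof.
elim: r F => [|l r IHr] F /=; first by rewrite big_nil.
rewrite cat_uniq => /and3P[ul dlr ur] iF; rewrite big_cat /=.
have djl : [disjoint l & flatten r] by rewrite disjoint_sym disjoint_has.
rewrite -[RHS]add0r; congr (_ + _).
  have E1 c' : F c' * wts (l :: r) c' = (F c' * wts r c') * wt (map c' l).
    by rewrite /wts big_cons mulrA mulrAC.
  rewrite (eq_big_seq (fun d => F c * wts r c *
             so3_act p q d (fun c' => wt (map c' l)) c)).
    by rewrite -mulr_sumr so3_act_wt // mulr0.
  move=> d dl; rewrite /so3_act mulr_sumr; apply: eq_bigr => j _.
  rewrite E1 iF ?mem_cat ?dl // (indep_wts djl) //.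
  by rewrite mulrCA.
pose F' c' := F c' * wt (map c' l).
rewrite -[RHS](IHr F') //.
  apply: eq_bigr => d _; apply: eq_bigr => j _; congr (_ * _).
  by rewrite /F' /wts big_cons mulrA.
move=> d c' j dr; rewrite /F' iF ?mem_cat ?dr ?orbT //.
have drl : [disjoint flatten r & l] by rewrite disjoint_sym.
by have /= -> := indep_wt drl c' j dr.
Qed.

(** The elementary quartic tensor at the index (p, p, p, q): acting on it with the
    rotation in the plane of [p] and [q] gives
    [pppp] - [qppq] - [pqpq] - [ppqq], for distinct [p] and [q]. *)
Definition corner (p q i j k l : 'I_3) : 'F_5 :=
  [&& i == p, j == p, k == p & l == q]%:R.

Definition so3_corner (p q i j k l : 'I_3) : 'F_5 :=
  \sum_(t <- ord3s) so3_gen p q i t * corner p q t j k l +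
  \sum_(t <- ord3s) so3_gen p q j t * corner p q i t k l +
  \sum_(t <- ord3s) so3_gen p q k t * corner p q i j t l +
  \sum_(t <- ord3s) so3_gen p q l t * corner p q i j k t.

(** Summing these tensors over the ordered pairs of distinct colours gives twice
    the diagonal tensors [pppp] minus all off-diagonal terms of the three
    pairings.  The pairings contain each diagonal tensor 3 times, and 3 + 2 = 0
    in F_5. *)
Lemma pairings_so3_corner (i j k l : 'I_3) :
  (i == j)%:R * (k == l)%:R + (i == k)%:R * (j == l)%:R +
  (i == l)%:R * (j == k)%:R
  = - \sum_(p <- ord3s) \sum_(q <- ord3s) so3_corner p q i j k l.
Proof.
rewrite /so3_corner /ord3s !big_cons !big_nil; apply/eqP; move: l;
  apply: all_ord3.
move: k; apply: all_ord3; move: j; apply: all_ord3; move: i; apply: all_ord3.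
by vm_compute.
Qed.

(** The sum of the three ways of joining four half-edges in pairs vanishes: it is
    a combination of rotations acting on a four-valent vertex, and the rest of
    the network is invariant. *)
Lemma tait_pairings a b c d r :
    perm_eq (flatten ([:: a; b; c; d] :: r)) (enum {: dart}) ->
  tait ([:: a; b] :: [:: c; d] :: r) + tait ([:: a; c] :: [:: b; d] :: r) +
  tait ([:: a; d] :: [:: b; c] :: r) = 0.
Proof.
move=> all_r.
have ur : uniq (flatten ([:: a; b; c; d] :: r)).
  by rewrite (perm_uniq all_r) enum_uniq.
have [ul dlr {}ur] : [/\ uniq [:: a; b; c; d],
  [disjoint [:: a; b; c; d] & flatten r]
    & uniq (flatten r)].
  move: ur; rewrite -[flatten _]/([:: a; b; c; d] ++ flatten r) cat_uniq.
  by case/and3P=> -> nh ->; rewrite disjoint_sym disjoint_has.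
have negl p q : \sum_(x : labels) matched x * (wts r x *
    so3_corner p q (x a) (x b) (x c) (x d)) = 0.
  pose F (x : labels) := corner p q (x a) (x b) (x c) (x d).
  (* The invariance of the remaining vertices leaves only the action on the four
     half-edges [a], [b], [c], [d]. *)
  have := so3_act_closed p q (fun x => F x * wts r x).
  rewrite exchange_big /= => sum0; rewrite -[RHS]sum0; apply: eq_bigr => x _.
  rewrite -mulr_sumr; congr (_ * _).
  rewrite -big_enum /= -(perm_big _ all_r) /=.
  rewrite -[_ :: _]/([:: a; b; c; d] ++ flatten r) big_cat /=.
  rewrite [X in _ + X]so3_act_wts // ?addr0; last first.
    have drl : [disjoint flatten r & [:: a; b; c; d]] by rewrite disjoint_sym.
    move=> t y j tr; rewrite /F.
    have E1 (z : labels) : (forall u, u \in [:: a; b; c; d] -> z u = y u) ->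
      F z = F y.
      by move=> zy; rewrite /F !zy // !inE eqxx ?orbT.
    apply: E1 => u us; rewrite updN //; apply: contraTneq us => ->.
    by rewrite (disjointFr drl tr).
  have E1 t : t \in [:: a; b; c; d] ->
      so3_act p q t (fun x => F x * wts r x) x = wts r x * so3_act p q t F x.
    move=> ts; rewrite /so3_act mulr_sumr; apply: eq_bigr => j _.
    by have /= -> := indep_wts dlr x j ts; rewrite mulrA mulrC.
  rewrite (eq_big_seq _ E1) -mulr_sumr; congr (_ * _).
  rewrite !big_cons big_nil addr0 /so3_act /F !sum_ord3 /so3_corner.
  move: ul; rewrite /= !inE !negb_or -!andbA =>
    /and5P[ab ac ad bc] /and3P[bd cd _].
  rewrite -!addrA; congr (_ + (_ + (_ + _))); apply: eq_bigr => t _;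
    congr (_ * _).
  - by rewrite updE !updN // eq_sym.
  - by rewrite updE !updN // eq_sym.
  - by rewrite updE !updN // eq_sym.
  - by rewrite updE !updN // eq_sym.
rewrite !tait_darts -!big_split /=.
have E1 (x : labels) : matched x * wts ([:: a; b] :: [:: c; d] :: r) x +
      matched x * wts ([:: a; c] :: [:: b; d] :: r) x +
      matched x * wts ([:: a; d] :: [:: b; c] :: r) x =
   - \sum_(p <- ord3s) \sum_(q <- ord3s) matched x * (wts r x *
      so3_corner p q (x a) (x b) (x c) (x d)).
  under eq_bigr do rewrite -!mulr_sumr; rewrite -!mulr_sumr -!mulrDr -!mulrN.
  rewrite -pairings_so3_corner !mulrDr /wts !big_cons /= -/(wts r x).
  by rewrite ![wts r x * _]mulrC -!mulrA.
under eq_bigr do rewrite E1.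
rewrite sumrN exchange_big /= big1 ?oppr0 // => p _.
by rewrite exchange_big /= big1.
Qed.

End Rotations.

(** * The local behaviour of the two sides of the identity *)
Section LocalRules.
Variable E : finType.
Notation dart := (E * bool)%type.
Implicit Types (e : E) (d : dart) (l s u v : seq dart) (gs r : seq (seq dart)).

Definition ncubic gs := count (fun l => size l == 3%N) gs.
Definition tait_square gs : 'F_5 := 2%:R ^+ (ncubic gs)./2 * tait gs ^+ 2.
Definition gap gs : 'F_5 := nflow gs - tait_square gs.

Lemma nflow_perm gs gs' : perm_eq gs gs' -> nflow gs = nflow gs'.
Proof. by move=> p; apply: eq_bigr => x _; congr (_ * _); apply: perm_big. Qed.

Lemma tait_perm gs gs' : perm_eq gs gs' -> tait gs = tait gs'.
Proof. by move=> p; apply: eq_bigr => x _; apply: perm_big. Qed.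

Lemma gap_perm gs gs' : perm_eq gs gs' -> gap gs = gap gs'.
Proof.
move=> p; rewrite /gap /tait_square (nflow_perm p) (tait_perm p).
by rewrite /ncubic (permP p).
Qed.

Lemma eps_swap i j k : eps j i k = - eps i j k.
Proof.
have gen (R : comPzRingType) (x y z : R) :
  3%:R * (x - y) * (z - y) * (z - x) =
    - (3%:R * (y - x) * (z - x) * (z - y)) by ring.
exact: gen.
Qed.

Lemma eps_rot i j k : eps j k i = eps i j k.
Proof.
have gen (R : comPzRingType) (x y z : R) :
  3%:R * (z - y) * (x - y) * (x - z) =
    3%:R * (y - x) * (z - x) * (z - y) by ring.
exact: gen.
Qed.

Lemma wt_perm l l' : perm_eq l l' ->
  exists2 sg : 'F_5, sg * sg = 1 &
    forall c : dart -> 'I_3, wt (map c l') = sg * wt (map c l).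
Proof.
pose P l' := exists2 sg : 'F_5, sg * sg = 1 &
    forall c : dart -> 'I_3, wt (map c l') = sg * wt (map c l).
suff step s1 s2 s3 : exists2 sg : 'F_5, sg * sg = 1 & forall c : dart -> 'I_3,
    wt (map c (s2 ++ s1 ++ s3)) = sg * wt (map c (s1 ++ s2 ++ s3)).
  move=> ll'; apply: (@catCA_perm_ind _ P) ll' _; last first.
    by exists 1 => [|c]; rewrite mul1r.
  move=> s1 s2 s3 [sg sg1 Esg]; have [sg' sg1' Esg'] := step s1 s2 s3.
  exists (sg' * sg) => [|c]; first by rewrite mulrACA sg1 sg1' mul1r.
  by rewrite Esg' Esg mulrA.
have id1 s s' : (forall c : dart -> 'I_3, wt (map c s') = wt (map c s)) ->
    exists2 sg : 'F_5, sg * sg = 1 &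
    forall c : dart -> 'I_3, wt (map c s') = sg * wt (map c s).
  by move=> E1; exists 1 => [|c]; rewrite ?E1 mul1r.
have big s s' : perm_eq s s' -> (3 < size s)%N ->
    exists2 sg : 'F_5, sg * sg = 1 &
    forall c : dart -> 'I_3, wt (map c s') = sg * wt (map c s).
  move=> pss s3'; apply: id1 => c; move: (perm_size pss) s3' => {pss}.
  by case: s => [|? [|? [|? [|? ?]]]] //; case: s' => [|? [|? [|? [|? ?]]]].
have [|le3] := ltnP 3 (size (s1 ++ s2 ++ s3)).
  by apply: big; rewrite perm_catCA.
case: s1 le3 => [|x1 [|x2 [|x3 s1]]]; first by move=> _; apply: id1.
- case: s2 => [|y1 [|y2 [|y3 s2]]] //; first by move=> _; apply: id1.
  + case: s3 => [|z1 [|z2 s3]] // _.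
      by apply: id1 => c; rewrite /= eq_sym.
    exists (-1) => [|c]; first by rewrite mulrNN mulr1.
    by rewrite /= mulN1r eps_swap.
  + by case: s3 => [|z1 s3] // _; apply: id1 => c /=; rewrite eps_rot.
- case: s2 => [|y1 [|y2 s2]] //; first by move=> _; apply: id1.
  by case: s3 => [|z1 s3] // _; apply: id1 => c /=; rewrite -eps_rot.
- case: s1 => [|x4 s1] //; case: s2 => [|y1 s2] // _.
  exact: id1.
Qed.

(** Reordering a vertex changes [tait] by a sign, which the square absorbs. *)
Lemma gap_inner l l' r : perm_eq l l' -> gap (l :: r) = gap (l' :: r).
Proof.
move=> p; rewrite /gap /tait_square /ncubic /= (perm_size p); congr (_ - _ * _).
  apply: eq_bigr => x _; rewrite !big_cons; congr (_ * (_ * _)).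
  by rewrite (excess_perm x p).
have [sg sg1 Esg] := wt_perm p.
have -> : tait (l' :: r) = sg * tait (l :: r).
  rewrite /tait mulr_sumr; apply: eq_bigr => x _.
  by rewrite /wts !big_cons Esg mulrA.
by rewrite exprMn -[sg ^+ 2]/(sg * sg) sg1 mul1r.
Qed.

Lemma tait_inner2 i j r : tait ([:: i; j] :: r) = tait ([:: j; i] :: r).
Proof.
by apply: eq_bigr => x _; rewrite /wts !big_cons /= eq_sym.
Qed.

Lemma nflow_leaf d r : nflow ([:: d] :: r) = 0.
Proof.
apply: big1 => x _; rewrite big_cons excess_cons /excess big_nil addr0.
rewrite mulf_eq0 signr_eq0 /= (bigD1 d.1) //=.
by case: (x d.1 == 0); rewrite ?(mul0r, mulr0).
Qed.

Lemma gap_leaf d r : gap ([:: d] :: r) = 0.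
Proof.
rewrite /gap nflow_leaf /tait_square [tait _]big1 ?expr0n ?mulr0 ?subrr // =>
  x _.
by rewrite /wts big_cons mul0r.
Qed.

(** The third half-edge at a loop is a bridge, so it carries no flow; and a
    proper colouring cannot use the same colour twice at a vertex. *)
Lemma gap_loop d a r : gap ([:: d; flip d; a] :: r) = 0.
Proof.
rewrite /gap; have -> : nflow ([:: d; flip d; a] :: r) = 0.
  rewrite -[RHS](nflow_leaf a r); apply: eq_bigr => x _.
  rewrite !big_cons; congr (_ * (_ * _)); congr (_ == _)%:R.
  rewrite !excess_cons /= addrA; case: d.2; rewrite /= expr0 expr1.
    by rewrite mul1r mulN1r addNr add0r.
  by rewrite mul1r mulN1r subrr add0r.
rewrite /tait_square [tait _]big1 ?expr0n ?mulr0 ?subrr // => x _.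
by rewrite /wts big_cons /= /eps subrr mulr0 !mul0r.
Qed.

Lemma off_uniq d s : uniq (d :: flip d :: s) -> off d.1 s.
Proof.
case: d => e o /= /and3P[n1 n2 _]; apply/allP => -[e' o'] /= ds.
apply: contraTneq ds => ->; move: n1 n2; rewrite inE negb_or => /andP[_].
by case: o o' => [] [] //=; move=> /negPf -> // /negPf ->.
Qed.

(** At the end of degree 2 the deletion would leave [a] alone, with no flow and no
    colouring, so only the contraction remains; the sign is that of the free
    circle. *)
Lemma gap_join d a s r :
    off d.1 (a :: s) -> off d.1 (flatten r) ->
  gap ([:: d; a] :: (flip d :: s) :: r) =
  - gap ((a :: s) :: [:: d; flip d] :: r).
Proof.
move=> oas or; have /andP[oa os] := oas.
rewrite /gap nflow_contract_delete ?nflow_leaf ?sub0r //=; last by rewrite oa.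
rewrite /tait_square tait_join // exprMn opprB /ncubic /=.
rewrite addrC; congr (_ - _).
have -> : 2%:R ^+ 2 = -1 :> 'F_5 by apply/eqP.
by rewrite mulN1r mulrN opprK.
Qed.

(** Apart from the first term, which is the difference for a simpler graph, the
    right-hand side is symmetric in [a], [b], [c], [d]: with T1 + T2 + T3 = 0 one
    has 8 (T2 - T3)^2 - T1^2 = T1^2 + T2^2 + T3^2 in F_5. *)
Lemma gap_ihx d0 a b c d r :
    perm_eq (flatten ([:: d0; a; b] :: [:: flip d0; c; d] :: r))
      (enum {: dart}) ->
  let C := [:: d0; flip d0] in
  gap ([:: d0; a; b] :: [:: flip d0; c; d] :: r) =
  gap ([:: a; b] :: [:: c; d] :: C :: r)
  - nflow ([:: a; b; c; d] :: C :: r)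
  - 2%:R ^+ (ncubic r)./2 * (tait ([:: a; b] :: [:: c; d] :: C :: r) ^+ 2 +
       tait ([:: a; c] :: [:: b; d] :: C :: r) ^+ 2 +
       tait ([:: a; d] :: [:: b; c] :: C :: r) ^+ 2).
Proof.
move=> all_gs C.
have all4 : perm_eq (flatten ([:: a; b; c; d] :: C :: r)) (enum {: dart}).
  by apply: perm_trans all_gs; apply/permP => p; rewrite /= ?count_cat /=; lia.
have ugs : uniq (d0 :: flip d0 :: ([:: a; b; c; d] ++ flatten r)).
  rewrite -(perm_uniq
    (s1 := flatten ([:: d0; a; b] :: [:: flip d0; c; d] :: r))).
    by rewrite (perm_uniq all_gs) enum_uniq.
  by apply/permP => p; rewrite /= ?count_cat /=; lia.
have := off_uniq ugs; rewrite /off all_cat => /andP[o4 or].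
have /= /and5P[oa ob oc od _] := o4.
have := tait_pairings all4.
rewrite /gap nflow_contract_delete /= ?oa ?ob ?oc ?od //
  /tait_square tait_ihx //.
rewrite /ncubic /= -/(ncubic r) !add0n exprS.
set N1 := nflow _; set N4 := nflow _.
set T2 := tait ([:: a; c] :: _); set T3 := tait ([:: a; d] :: _).
set T1 := tait ([:: a; b] :: _); move=> T0.
(* The relation special to characteristic 5 eliminates T1. *)
have -> : T1 = - (T2 + T3) by apply/eqP; rewrite -addr_eq0 addrA T0.
have gen (R : comPzRingType) (x4 x1 y z w : R) :
   x1 - x4 - 2%:R * w * (2%:R * (y - z)) ^+ 2 =
   x1 - w * (- (y + z)) ^+ 2 - x4 - w * ((- (y + z)) ^+ 2 + y ^+ 2 + z ^+ 2)
   + 5%:R * (w * (4%:R * y * z - y ^+ 2 - z ^+ 2)) by ring.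
by rewrite gen nat5_F5 mul0r addr0.
Qed.

End LocalRules.

(** * Reduction of cycles *)
Section Reduction.
Variable E : finType.
Notation dart := (E * bool)%type.
Implicit Types (e : E) (a b d p t x y : dart) (l s u v : seq dart)
  (gs r us : seq (seq dart)).

Lemma flipK : involutive (@flip E).
Proof. by case=> e o; rewrite /flip /= negbK. Qed.

Lemma flip_neq d : flip d != d.
Proof. by case: d => e []; rewrite /flip xpair_eqE eqxx. Qed.

Definition circle l := all (fun d => flip d \in l) l.

(** The quantity for the induction.  Exchanges preserve it, while deletions and
    contractions decrease it: they turn cubic vertices into vertices of degree 2,
    or a vertex of degree 2 into a free circle, which counts for nothing. *)
Definition weight l : nat :=
  if size l == 3%N then 3%N else (size l == 2%N) && ~~ circle l.
Definition total_weight gs : nat := \sum_(l <- gs) weight l.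
Definition subcubic gs :=
  perm_eq (flatten gs) (enum {: dart}) && all (fun l => size l <= 3)%N gs.

Lemma subcubic_perm gs gs' : perm_eq gs gs' -> subcubic gs = subcubic gs'.
Proof.
move=> p; rewrite /subcubic (perm_all _ p); congr (_ && _).
by rewrite (permPl (perm_flatten p)).
Qed.

Lemma total_weight_perm gs gs' : perm_eq gs gs' ->
  total_weight gs = total_weight gs'.
Proof. exact: perm_big. Qed.

Lemma weight_perm l l' : perm_eq l l' -> weight l = weight l'.
Proof.
move=> p; rewrite /weight (perm_size p) /circle (perm_all _ p).
by under eq_all => d do rewrite (perm_mem p).
Qed.

Lemma subcubic_inner l l' r : perm_eq l l' ->
  subcubic (l :: r) = subcubic (l' :: r).
Proof.
move=> p; rewrite /subcubic /= (perm_size p); congr (_ && _).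
by have /permPl -> : perm_eq (l ++ flatten r) (l' ++ flatten r)
  by rewrite perm_cat2r.
Qed.

Lemma subcubic_uniq gs : subcubic gs -> uniq (flatten gs).
Proof. by case/andP=> p _; rewrite (perm_uniq p) enum_uniq. Qed.

Lemma subcubic_mem gs d : subcubic gs -> d \in flatten gs.
Proof. by case/andP=> p _; rewrite (perm_mem p) mem_enum. Qed.

Lemma total_weight_cons l r : total_weight (l :: r) =
  (weight l + total_weight r)%N.
Proof. by rewrite /total_weight big_cons. Qed.

Lemma weight_circle d : weight [:: d; flip d] = 0%N.
Proof. by rewrite /weight /circle /= !inE flipK !eqxx orbT. Qed.

Lemma weight_size2 l : size l = 2%N -> (weight l <= 1)%N.
Proof. by rewrite /weight => -> /=; case: (circle l). Qed.

(** A walk that leaves along [d], visits the vertices [us] in order without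
    turning back at any of them, and whose last outgoing half-edge is [t].  When
    [t] is the partner of a half-edge at the starting vertex, the walk closes. *)
Fixpoint route d us t {struct us} : bool :=
  if us is u :: us' then
    (flip d \in u) && has (fun x => (x != flip d) && route x us' t) u
  else d == t.

(** An open walk of the same kind, to be closed by [route_chain]. *)
Fixpoint chain p us {struct us} : bool :=
  if us is u :: us' then
    (flip p \in u) && has (fun x => (x != flip p) && chain x us') u
  else true.

Lemma route_chain us p a : chain p us -> flip a \in flatten us -> a != p ->
    a \notin flatten us ->
  exists us1 us2, us = us1 ++ us2 /\ route p us1 (flip a).
Proof.
elim: us p => //= v us IHus p /andP[fpv /hasP[x xv /andP[xp cx]]].
rewrite !mem_cat negb_or => + ap /andP[av aus].
have [fav _|_ /= faus] := boolP (flip a \in v).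
  exists [:: v], us; split=> //=; rewrite fpv; apply/hasP;
    exists (flip a) => //.
  by rewrite eqxx andbT (inj_eq (inv_inj flipK)).
have [|us1 [us2 [-> r1]]] := IHus x cx faus _ aus.
  by apply: contraNneq av => ->.
exists (v :: us1), us2; split=> //=; rewrite fpv; apply/hasP; exists x => //.
by rewrite xp.
Qed.

Section Step.
Variable m : nat.
Hypothesis IH : forall gs, subcubic gs -> (total_weight gs < m)%N -> gap gs = 0.

Definition good gs := subcubic gs && (total_weight gs <= m)%N.

Lemma good_perm gs gs' : perm_eq gs gs' -> good gs = good gs'.
Proof. by move=> p; rewrite /good (subcubic_perm p) (total_weight_perm p). Qed.

Lemma good_inner l l' r : perm_eq l l' -> good (l :: r) = good (l' :: r).
Proof.
by move=> p; rewrite /good (subcubic_inner _ p) !total_weight_cons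
  (weight_perm p).
Qed.

Lemma gap_good_inner2 u v u' v' r : perm_eq u u' -> perm_eq v v' ->
  gap (u :: v :: r) = gap (u' :: v' :: r) /\
  good (u :: v :: r) = good (u' :: v' :: r).
Proof.
move=> pu pv; have p w s : perm_eq (w :: s :: r) (s :: w :: r).
  by rewrite -[w :: _]/([:: w] ++ [:: s] ++ r) perm_catCA.
split; first by rewrite (gap_inner _ pu) (gap_perm (p _ _)) (gap_inner _ pv)
  (gap_perm (p _ _)).
by rewrite (good_inner _ pu) (good_perm (p _ _)) (good_inner _ pv)
  (good_perm (p _ _)).
Qed.

Lemma good_swap u v r : good (u :: v :: r) = good (v :: u :: r).
Proof. by apply: good_perm;
  rewrite -[u :: _]/([:: u] ++ [:: v] ++ r) perm_catCA. Qed.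

Lemma gap_swap u v r : gap (u :: v :: r) = gap (v :: u :: r).
Proof. by apply: gap_perm;
  rewrite -[u :: _]/([:: u] ++ [:: v] ++ r) perm_catCA. Qed.

Lemma size2_rem l d : size l = 2%N -> d \in l -> exists a, perm_eq l [:: d; a].
Proof.
move=> sl dl; have p := perm_to_rem dl; move: (perm_size p);
  rewrite sl /= => -[].
by case: (rem d l) p => [|a []] // p _; exists a.
Qed.

Lemma size3_rem l d a : size l = 3%N -> d \in l -> a \in l -> a != d ->
  exists b, perm_eq l [:: d; a; b].
Proof.
move=> sl dl al ad; have p := perm_to_rem dl.
have ar : a \in rem d l by move: al; rewrite (perm_mem p) inE (negPf ad).
have [|b pb] := size2_rem _ ar; last first.
  by exists b; apply: perm_trans p _; rewrite perm_cons.
by move: (perm_size p); rewrite sl /= => -[].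
Qed.

(** Contracting the edge of [d] leaves a free circle in place of [u], so the
    induction hypothesis applies. *)
Lemma gap_join2 u v r d : good (u :: v :: r) -> d \in u -> flip d \in v ->
  size u = 2%N -> gap (u :: v :: r) = 0.
Proof.
move=> + du dv su; have [a pu] := size2_rem su du; have pv := perm_to_rem dv.
have [-> ->] := gap_good_inner2 r pu pv;
  move: (rem _ v) => s {u v du dv su pu pv}.
move=> /andP[sub le_m].
have p : perm_eq (flatten ([:: d; a] :: (flip d :: s) :: r))
     (d :: flip d :: ((a :: s) ++ flatten r)).
  by apply/permP => q; rewrite /= ?count_cat /=; lia.
have := subcubic_uniq sub; rewrite (perm_uniq p) => ud.
have := off_uniq ud; rewrite /off all_cat => /andP[os or].
rewrite gap_join // IH ?oppr0 //.
  move: sub; rewrite /subcubic /= !ltnS => /andP[p' ->]; rewrite andbT.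
  by apply: perm_trans p'; apply/permP => q; rewrite /= ?count_cat /=; lia.
apply: leq_trans le_m;
  rewrite !total_weight_cons weight_circle add0n addnA ltn_add2r.
have nd : a != flip d.
  by apply: contraTneq ud => ->; rewrite /= !inE eqxx /= andbF.
have ns : flip d \notin s.
  apply: contraTN ud => fs.
  by rewrite /= !(inE, mem_cat) fs !orbT /= andbF.
have nds : d \notin s.
  apply: contraTN ud => fs.
  by rewrite /= !(inE, mem_cat) fs !orbT.
rewrite {2}/weight /= /circle /= !inE (negPf (flip_neq d)) [flip d == a]eq_sym
  (negPf nd) /=.
case: s ns nds {sub p ud os or} => [|b [|b' [|b'' s]]] //=;
  rewrite /weight /circle /=.
rewrite !inE => nb db;
  rewrite flipK [d == flip d]eq_sym (negPf (flip_neq d)) (negPf db).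
by case: (_ && _).
Qed.

Lemma gap_non_cubic_end u v r d : good (u :: v :: r) -> d \in u ->
  flip d \in v ->
  size u != 3%N \/ size v != 3%N -> gap (u :: v :: r) = 0.
Proof.
move=> g du dv szuv.
have leaf w w' d' : d' \in w -> size w = 1%N -> gap (w :: w' :: r) = 0.
  by case: w => [|x []] // _ _; rewrite gap_leaf.
have /and4P[_ su sv _] : [&& true, size u <= 3, size v <= 3
    & all (fun l => size l <= 3) r]%N.
  by case/andP: g => /andP[_ /=].
have [su1|su1] := eqVneq (size u) 1%N; first exact: leaf du su1.
have [sv1|sv1] := eqVneq (size v) 1%N;
  first by rewrite gap_swap (leaf _ _ _ dv).
have [su2|su2] := eqVneq (size u) 2%N; first exact: gap_join2 g du dv su2.
have [sv2|sv2] := eqVneq (size v) 2%N.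
  by rewrite gap_swap (@gap_join2 _ _ _ (flip d)) ?flipK // good_swap.
have su0 : size u != 0%N by case: (u) du.
have sv0 : size v != 0%N by case: (v) dv.
move: su su0 su1 su2 sv sv0 sv1 sv2 szuv.
by case: (size u) (size v) =>
  [|[|[|[|?]]]] [|[|[|[|?]]]] //= _ _ _ _ _ _ _ _ [].
Qed.

Lemma gap_smooth d a b x y r :
  good ([:: d; a; b] :: [:: flip d; x; y] :: r) ->
  gap ([:: a; b] :: [:: x; y] :: [:: d; flip d] :: r) = 0.
Proof.
case/andP=> sub le_m; apply: IH.
  case/andP: sub => p /= al; rewrite /subcubic /= al andbT.
  by apply: perm_trans p; apply/permP => q /=; lia.
apply: leq_trans le_m;
  rewrite !total_weight_cons weight_circle add0n !addnA ltn_add2r.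
have -> : weight [:: d; a; b] = 3%N by [].
have -> : weight [:: flip d; x; y] = 3%N by [].
have l1 := @weight_size2 [:: a; b] erefl.
have l2 := @weight_size2 [:: x; y] erefl.
by move: (weight _) (weight _) l1 l2 => [|[]] // [|[]].
Qed.

(** The half-edges [a] and [y] are exchanged across the edge of [d]; both graphs
    have the same right-hand side in [gap_ihx]. *)
Lemma gap_exchange d a b x y r :
  good ([:: d; a; b] :: [:: flip d; x; y] :: r) ->
  let u := [:: flip d; x; a] in let v := [:: d; b; y] in
  good (u :: v :: r) /\
  gap ([:: d; a; b] :: [:: flip d; x; y] :: r) = gap (u :: v :: r).
Proof.
move=> g u v; have gvu : good (v :: u :: r).
  have /andP[/andP[p al] le_m] := g; apply/andP; split.
    rewrite /= in al; rewrite /subcubic /= al andbT.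
    by apply: perm_trans p; apply/permP => q /=; lia.
  by apply: leq_trans le_m; rewrite !total_weight_cons.
split; first by rewrite good_swap.
have perm1 w : good w -> perm_eq (flatten w) (enum {: dart}).
  by case/andP => /andP[].
rewrite (gap_swap u) !gap_ihx ?perm1 // !gap_smooth // !sub0r.
pose T (i j k h : dart) := tait ([:: i; j] :: [:: k; h] :: [:: d; flip d] :: r).
have Tl i j k h : T i j k h = T j i k h by rewrite /T tait_inner2.
have Tlr i j k h : T i j k h = T k h i j.
  apply: tait_perm.
  by rewrite -[[:: i; j] :: _]/([:: _] ++ [:: _] ++ _) perm_catCA.
rewrite -/(T a b x y) -/(T a x b y) -/(T a y b x).
rewrite -/(T b y x a) -/(T b x y a) -/(T b a y x).
have -> : T b y x a = T a x b y by rewrite Tlr Tl.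
have -> : T b x y a = T a y b x by rewrite Tlr (Tl y a).
have -> : T b a y x = T a b x y by rewrite Tl Tlr Tl Tlr.
have -> : nflow ([:: b; y; x; a] :: [:: d; flip d] :: r) =
          nflow ([:: a; b; x; y] :: [:: d; flip d] :: r).
  apply: eq_bigr => z _; rewrite !big_cons; congr (_ * (_ * _)).
  by rewrite (@excess_perm _ _ _ _ [:: a; b; x; y]) //; apply/permP => q /=;
    lia.
by congr (_ - _ * _); rewrite [RHS]addrC addrA.
Qed.

(** The cycle starts at [u] along [d] and comes back through [a].  Exchanging [a]
    with the half-edge at the next vertex that the cycle does not use moves the
    return point to that vertex, so that the cycle becomes shorter by one. *)
Lemma gap_cycle us u r d a :
    good (u :: us ++ r) -> size u = 3%N -> d \in u -> a \in u -> a != d ->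
    route d us (flip a) ->
  gap (u :: us ++ r) = 0.
Proof.
elim: us u r d a => [|v us IHus] u r d a g su du au ad /=.
  move/eqP=> dfa; have [|b p] := size3_rem su au du; first by rewrite eq_sym.
  by rewrite (gap_inner _ p) dfa gap_loop.
case/andP=> fv /hasP[x xv /andP[xf rx]].
have [sv|sv] := eqVneq (size v) 3%N; last by apply: (gap_non_cubic_end g du fv);
  right.
have [b pu] := size3_rem su du au ad; have [y pv] := size3_rem sv fv xv xf.
have [E1 E2] := gap_good_inner2 (us ++ r) pu pv; move: g; rewrite /= E1 E2 => g.
(* After the exchange, the vertex [v] carries the return point [a], and [u] has
   left the cycle. *)
have [g' ->] := gap_exchange g.
set u' := [:: _; x; a]; set v' := [:: _; b; y].
have p : perm_eq (u' :: v' :: us ++ r) (u' :: us ++ v' :: r).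
  by rewrite perm_cons perm_sym -cat1s perm_catCA.
rewrite (gap_perm p) (IHus u' (v' :: r) x a) //;
  first by rewrite -(good_perm p).
- by rewrite !inE eqxx orbT.
- by rewrite !inE eqxx !orbT.
have /andP[/subcubic_uniq + _] := g'.
by rewrite /= !(inE, mem_cat) => /and3P[_ + _];
  rewrite !negb_or eq_sym => /andP[].
Qed.

(** A walk that never turns back is prolonged from its head [u], the list [us]
    being the vertices already visited, most recent first; as there are finitely
    many vertices, it closes up into a cycle. *)
Lemma gap_cubic_vertex r us u p :
    good (u :: us ++ r) -> size u = 3%N -> p \in u -> chain p us ->
  gap (u :: us ++ r) = 0.
Proof.
have [n] := ubnP (size r); elim: n r us u p => // n IHn r us u p szr g su pu cp.
have /andP[sub _] := g; have ug := subcubic_uniq sub.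
have [a au ap] : exists2 a, a \in u & a != p.
  have uu : uniq u by move: ug; rewrite /= cat_uniq => /andP[].
  have := perm_size (perm_to_rem pu); rewrite su /= => -[].
  case E1: (rem p u) => [|a s] // _; exists a.
    by apply: (@mem_rem _ p); rewrite E1 mem_head.
  have : a \in rem p u by rewrite E1 mem_head.
  by rewrite mem_rem_uniq // inE => /andP[].
have := subcubic_mem (flip a) sub; rewrite /= flatten_cat !mem_cat.
case/or3P => [fu|fus|fr].
- by apply: (@gap_cycle [::] u (us ++ r) (flip a) a) => //=;
  rewrite eq_sym flip_neq.
- have nus : a \notin flatten us.
    move: ug; rewrite /= flatten_cat cat_uniq => /and3P[_ + _].
    by apply: contra => aus; apply/hasP; exists a; rewrite // mem_cat aus.
  have [us1 [us2 [E1 r1]]] := route_chain cp fus ap nus.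
  by move: g; rewrite E1 -catA => g; apply: (gap_cycle g su pu au ap r1).
have /flattenP[w wr fw] := fr.
have pr := perm_to_rem wr.
have [sw|sw] := eqVneq (size w) 3%N.
  have pg : perm_eq (u :: us ++ r) (w :: (u :: us) ++ rem w r).
    rewrite -cat1s -[w :: _]/([:: w] ++ _) perm_sym perm_catCA perm_cons.
    by rewrite perm_cat2l perm_sym.
  rewrite (gap_perm pg) (IHn _ _ _ (flip a)) //.
  - by rewrite size_rem //; case: (r) wr szr.
  - by rewrite -(good_perm pg).
  - by rewrite /= flipK au; apply/hasP; exists p => //; rewrite eq_sym ap.
have pg : perm_eq (u :: us ++ r) (u :: w :: us ++ rem w r).
  by rewrite perm_cons perm_sym -cat1s perm_catCA perm_cat2l perm_sym.
rewrite (gap_perm pg); apply: (gap_non_cubic_end _ au fw); last by right.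
by rewrite -(good_perm pg).
Qed.

End Step.

(** Each free circle contributes 4 to the flows and 3 to the colourings, and
    4 = 3^2 in F_5. *)
Lemma gap_circles gs :
  (forall l, l \in gs -> l = [::] \/ exists d, l = [:: d; flip d]) ->
    gap gs = 0.
Proof.
move=> cgs; have ncubic0 : ncubic gs = 0%N.
  apply/eqP; rewrite -leqn0 leqNgt -has_count; apply/hasPn => l /cgs.
  by case=> [|[d]] ->.
have -> : gap gs = nflow gs - tait gs ^+ 2
  by rewrite /gap /tait_square ncubic0 mul1r.
have -> : tait gs = 3%:R ^+ #|E|.
  rewrite /tait (eq_bigr (fun=> 1)) => [|c _]; last first.
    rewrite /wts big_seq big1 // => l /cgs[|[d]] -> //=.
    by rewrite eqxx.
  by rewrite sumr_const card_ffun card_ord natrX.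
have -> : nflow gs = (-1) ^+ #|E|.
  rewrite /nflow (eq_bigr (fun x : {ffun E -> 'F_5} => \prod_e (x e != 0)%:R)).
    rewrite -(bigA_distr_bigA (fun (_ : E) (t : 'F_5) => (t != 0)%:R)) /=.
    by rewrite sum_nz_F5 prodr_const.
  move=> x _; rewrite -[RHS]mulr1; congr (_ * _); rewrite big_seq.
  apply: big1 => l /cgs[|[d]] ->.
    by rewrite /excess big_nil eqxx.
  rewrite !excess_cons /excess big_nil addr0 /=.
  have -> : (-1) ^+ (~~ d.2) = - (-1) ^+ d.2 :> 'F_5.
    by case: d.2; rewrite /= ?expr0 ?expr1 ?opprK.
  by rewrite mulNr subrr eqxx.
rewrite -exprM mulnC exprM.
have -> : 3%:R ^+ 2 = -1 :> 'F_5 by apply/eqP.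
by rewrite subrr.
Qed.

Lemma gap_eq0 gs : subcubic gs -> gap gs = 0.
Proof.
have [n] := ubnP (total_weight gs); elim: n gs => // m IHm gs le_m sub.
have IH gs' : subcubic gs' -> (total_weight gs' < m)%N -> gap gs' = 0.
  by move=> s' m'; apply: IHm.
have g : good m gs by rewrite /good sub.
have [/hasP[u ugs /eqP su]|no3] := boolP (has (fun l => size l == 3%N) gs).
  have pg := perm_to_rem ugs; have [p pu] : exists p, p \in u.
    by case: (u) su => // p ? _; exists p; rewrite mem_head.
  rewrite (gap_perm pg); apply: (@gap_cubic_vertex m IH _ [::] u p) => //.
  by rewrite -(good_perm _ pg).
have [/hasP[u ugs]|no1] := boolP (has (fun l => size l == 1%N) gs).
  by case: u ugs => [|d []] // ugs _;
    rewrite (gap_perm (perm_to_rem ugs)) gap_leaf.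
have [/hasP[u ugs /andP[/eqP su /allPn[d du fu]]]|no2] :=
    boolP (has (fun l => (size l == 2%N) && ~~ circle l) gs).
  have pg := perm_to_rem ugs;
    have gg : good m (u :: rem u gs) by rewrite -(good_perm _ pg).
  have /andP[sub' _] := gg.
  have := subcubic_mem (flip d) sub'; rewrite /= mem_cat (negPf fu) /=.
  case/flattenP => v vr fv; have pg2 := perm_to_rem vr.
  have pg3 : perm_eq gs (u :: v :: rem v (rem u gs)).
    by apply: perm_trans pg _; rewrite perm_cons.
  rewrite (gap_perm pg3); apply: (gap_non_cubic_end IH _ du fv); last by left;
    rewrite su.
  by rewrite -(good_perm _ pg3).
apply: gap_circles => l lg.
have sl : (size l <= 3)%N by case/andP: sub => _ /allP; apply.
have s1 := hasPn no1 _ lg; have s2 := hasPn no2 _ lg; have s3 := hasPn no3 _ lg.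
case: l sl s1 s2 s3 {lg} => [|d [|d' [|d2 [|]]]] //= _ _ ; first by left.
rewrite negbK /circle /= !inE (negPf (flip_neq d)) => /andP[/eqP <- _] _.
by right; exists d.
Qed.

End Reduction.

(** * The flow polynomial counts flows over finite fields *)
Section FlowCount.
Variables (G : multigraph).
Notation dart := (edge G * bool)%type.

Definition endpt (d : dart) : vert G :=
  if d.2 then (ends d.1).1 else (ends d.1).2.

Definition star (v : vert G) : seq dart := enum [pred d : dart | endpt d == v].

Definition stars : seq (seq dart) := map star (enum (vert G)).

Lemma mem_star v d : (d \in star v) = (endpt d == v).
Proof. by rewrite mem_enum inE. Qed.

Lemma size_star v : size (star v) = degree v.
Proof.
rewrite -cardE -sum1_card /degree big_mkcond /=.
rewrite (eq_bigr (fun d : dart => (endpt (d.1, d.2) == v) : nat)); last first.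
  by case=> e o _; rewrite inE; case: (_ == v).
rewrite -(pair_bigA _ (fun e o => (endpt (e, o) == v) : nat)) /=.
apply: eq_bigr => e _; by rewrite big_bool.
Qed.

Lemma perm_stars : perm_eq (flatten stars) (enum {: dart}).
Proof.
apply: uniq_perm; rewrite ?enum_uniq //.
  rewrite /stars; elim: (enum (vert G)) (enum_uniq (vert G)) =>
    //= v vs IHv /andP[nv uv].
  rewrite cat_uniq IHv // andbT enum_uniq /=;
    apply/hasPn => d /flatten_mapP[v' vs'].
  rewrite !mem_star => /eqP ->; apply: contraNneq nv => <- //.
move=> d; rewrite mem_enum; apply/flatten_mapP; exists (endpt d).
  by rewrite mem_enum.
by rewrite mem_star.
Qed.

Section Field.
Variable K : finFieldType.
Implicit Types (A : {set edge G}).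

Definition flow (x : {ffun edge G -> K}) : bool :=
  [forall v, excess x (star v) == 0].

Definition nz_flow (x : {ffun edge G -> K}) : bool :=
  [forall e, x e != 0] && flow x.

Definition inc (e : edge G) (v : vert G) : K :=
  \sum_(o : bool) (-1) ^+ o * (endpt (e, o) == v)%:R.

Lemma excess_inc x v : excess x (star v) = \sum_e x e * inc e v.
Proof.
rewrite /excess /star big_enum /= big_mkcond /=.
rewrite (eq_bigr (fun d : dart =>
  x d.1 * ((-1) ^+ d.2 * (endpt (d.1, d.2) == v)%:R))).
  rewrite -(pair_bigA _
    (fun e (o : bool) => x e * ((-1) ^+ o * (endpt (e, o) == v)%:R))) /=.
  by apply: eq_bigr => e _; rewrite /inc mulr_sumr.
by case=> e o _; rewrite inE; case: (_ == v); rewrite /= ?mulr1 ?mulr0 // mulrC.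
Qed.

Lemma card_ker m n (M : 'M[K]_(m, n)) :
  #|[set u : 'rV[K]_m | u *m M == 0]| = (#|K| ^ (m - \rank M))%N.
Proof.
rewrite -mxrank_ker -card_rowg; apply: eq_card => u; rewrite inE mem_rowg.
by apply/eqP/sub_kermxP.
Qed.

Definition inc_mx A : 'M[K]_(#|A|, #|vert G|) :=
  \matrix_(i, j) inc (enum_val i) (enum_val j).

(** Flows supported in [A] form the kernel of the incidence matrix of [A]. *)
Lemma card_flows_rank A :
  #|[set x : {ffun edge G -> K} |
      flow x & [forall (e | e \notin A), x e == 0]]| =
  (#|K| ^ (#|A| - \rank (inc_mx A)))%N.
Proof.
rewrite -card_ker.
pose h (x : {ffun edge G -> K}) : 'rV[K]_#|A| := \row_i x (enum_val i).
have exc (x : {ffun edge G -> K}) : (forall e, e \notin A -> x e = 0) ->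
    forall j, (h x *m inc_mx A) 0 j = excess x (star (enum_val j)).
  move=> x0 j; rewrite excess_inc mxE (bigID (mem A)) /= [X in _ = _ + X]big1
    ?addr0.
    by rewrite [RHS]big_enum_val; apply: eq_bigr => i _; rewrite !mxE.
  by move=> e /x0 ->; rewrite mul0r.
rewrite -(card_in_imset (f := h)); last first.
  move=> x y; rewrite !inE =>
    /andP[_ /forall_inP x0] /andP[_ /forall_inP y0] hxy.
  apply/ffunP => e; have [eA|neA] := boolP (e \in A).
    by move/rowP/(_ (enum_rank_in eA e)): hxy; rewrite !mxE enum_rankK_in.
  by rewrite (eqP (x0 e neA)) (eqP (y0 e neA)).
apply: eq_card => u; rewrite inE; apply/imsetP/eqP => [[x]|uM].
  rewrite inE => /andP[/forallP fx /forall_inP x0] ->; apply/rowP => j.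
  by rewrite exc ?mxE; [apply/eqP | move=> e /x0/eqP].
pose x : {ffun edge G -> K} := [ffun e => \sum_i u 0 i * (enum_val i == e)%:R].
have hx : u = h x.
  apply/rowP => i; rewrite mxE ffunE (bigD1 i) //= eqxx mulr1 big1 ?addr0 // =>
    j ne.
  by rewrite (inj_eq enum_val_inj) (negPf ne) mulr0.
have x0 e : e \notin A -> x e = 0.
  move=> eA; rewrite ffunE big1 // => i _; case: eqP => [ie|_];
    last by rewrite mulr0.
  by rewrite -ie enum_valP in eA.
exists x => //; rewrite inE; apply/andP; split;
  last by apply/forall_inP => e /x0 ->.
apply/forallP => v; rewrite -[v]enum_rankK -exc // -hx uM mxE //.
Qed.

Lemma adjacent_sym A : connect_sym (adjacent A).
Proof.
apply: sym_connect_sym => u v; rewrite /adjacent.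
by apply: eq_existsb => e; rewrite orbC.
Qed.

(** A function on the vertices that is constant along the edges of [A] is a
    function on the components, that is on their roots. *)
Lemma card_potentials A :
  #|[set p : {ffun vert G -> K} |
      [forall (e | e \in A), p (ends e).1 == p (ends e).2]]| =
  (#|K| ^ ncomps A)%N.
Proof.
pose a := adjacent A; have sym : connect_sym a := adjacent_sym A.
have -> : ncomps A = #|{: {v | fingraph.roots a v}}|.
  by rewrite card_sig /ncomps /n_comp_mem; apply: eq_card => v;
    rewrite !inE andbT.
rewrite -card_ffun.
pose rt v : {v | fingraph.roots a v} :=
  Sub (fingraph.root a v) (roots_root sym v).
pose h (f : {ffun {v | fingraph.roots a v} -> K}) : {ffun vert G -> K} :=
  [ffun v => f (rt v)].
have rtK (s : {v | fingraph.roots a v}) : rt (val s) = s.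
  by apply: val_inj; rewrite /= (eqP (valP s)).
rewrite -cardsT -(card_imset (f := h)); last first.
  by move=> f g /ffunP fg; apply/ffunP => s; have := fg (val s);
    rewrite !ffunE rtK.
apply: eq_card => p; rewrite inE; apply/forall_inP/imsetP => [pA|[f _ -> e eA]].
  have pa u v : a u v -> p u = p v.
    case/existsP=> e /andP[eA]; have /eqP pe := pA e eA.
    by case/orP=> /eqP ee; rewrite ee /= in pe.
  have pr u v : connect a u v -> p u = p v.
    case/connectP=> s; elim: s u => /= [|w s IHs] u; first by move=> _ ->.
    by case/andP=> /pa -> /IHs.
  exists [ffun s => p (val s)] => //; apply/ffunP => v; rewrite !ffunE /=.
  exact/pr/connect_root.
rewrite !ffunE; apply/eqP; congr (f _); apply: val_inj => /=.
apply/(fingraph.rootP sym); apply: connect1; apply/existsP; exists e.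
by rewrite eA -surjective_pairing eqxx.
Qed.

(** The transpose of the incidence matrix maps a potential to its differences
    along the edges, and transposition preserves the rank. *)
Lemma rank_inc_mx A : (#|vert G| - \rank (inc_mx A) = ncomps A)%N.
Proof.
apply/eqP; rewrite -(eqn_exp2l _ _ (card_finNzRing_gt1 K)) -card_potentials.
rewrite -mxrank_tr -card_ker.
pose h (p : {ffun vert G -> K}) : 'rV[K]_#|vert G| := \row_j p (enum_val j).
rewrite -[X in _ == X](card_in_imset (f := h)); last first.
  move=> p q _ _ /rowP pq; apply/ffunP => v.
  by have := pq (enum_rank v); rewrite !mxE enum_rankK.
have hE p i : (h p *m (inc_mx A)^T) 0 i =
    p (ends (enum_val i)).2 - p (ends (enum_val i)).1.
  rewrite mxE (eq_bigr
    (fun j => p (enum_val j) * inc (enum_val i) (enum_val j))).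
    rewrite -(big_enum_val (fun v => p v * inc (enum_val i) v)) /=.
    have pt w : \sum_v p v * (w == v)%:R = p w.
      rewrite (bigD1 w) //= eqxx mulr1 big1 ?addr0 // => v ne.
      by rewrite eq_sym (negPf ne) mulr0.
    under eq_bigr do rewrite /inc big_bool
      /= expr0 expr1 mul1r mulN1r mulrDr mulrN.
    by rewrite big_split /= sumrN !pt addrC.
  by move=> j _; rewrite !mxE.
apply/eqP; apply: eq_card => u; rewrite inE; apply/eqP/imsetP => [uM|[p]].
  exists [ffun v => u 0 (enum_rank v)]; last first.
    by apply/rowP => j; rewrite mxE ffunE enum_valK.
  have hu : u = h [ffun v => u 0 (enum_rank v)].
    by apply/rowP => j; rewrite mxE ffunE enum_valK.
  rewrite inE; apply/forall_inP => e eA; rewrite eq_sym -subr_eq0.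
  by rewrite -[e](enum_rankK_in eA) // -hE -hu uM mxE.
rewrite inE => /forall_inP pA ->; apply/rowP => i; rewrite hE mxE.
by rewrite (eqP (pA _ (enum_valP i))) subrr.
Qed.

Lemma card_flows A :
  #|[set x : {ffun edge G -> K} |
      flow x & [forall (e | e \notin A), x e == 0]]| =
  (#|K| ^ (#|A| + ncomps A - #|vert G|))%N.
Proof.
rewrite card_flows_rank; congr (_ ^ _)%N.
by have := rank_inc_mx A; have := rank_leq_col (inc_mx A); lia.
Qed.

(** Inclusion-exclusion on the set of edges where the flow vanishes. *)
Theorem flow_poly_count :
  (flow_poly G).[#|K|%:R] =
    #|[set x : {ffun edge G -> K} | nz_flow x]|%:R :> int.
Proof.
rewrite /flow_poly horner_sum.
transitivity (\sum_(A : {set edge G}) (-1) ^+ (#|edge G| - #|A|) *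
   \sum_(x : {ffun edge G -> K} | flow x)
     ([forall (e | e \notin A), x e == 0])%:R : int).
  apply: eq_bigr => A _; rewrite hornerM hornerXn -natrX -card_flows.
  congr (_ * _); first by rewrite -[-1]/(- 1%:P) -polyCN -polyC_exp hornerC.
  rewrite -sum1_card natr_sum
    (eq_bigl (fun x => flow x && [forall (e | e \notin A), x e == 0])).
    by rewrite big_mkcondr; apply: eq_bigr => x _; case: ifP.
  by move=> x; rewrite inE.
under eq_bigr do rewrite mulr_sumr.
rewrite exchange_big /= -[in RHS]sum1_card natr_sum.
rewrite [RHS](eq_bigl (fun x => flow x && [forall e, x e != 0])); last first.
  by move=> x; rewrite inE /nz_flow andbC.
rewrite [RHS]big_mkcondr; apply: eq_bigr => x _.
transitivity (\prod_e (1 + - (x e == 0)%:R : int)).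
  rewrite bigA_distr; apply: eq_big => // A _.
  rewrite (bigID (mem A)) /= big1 ?mul1r; last by move=> e ->.
  rewrite (eq_bigr (fun e => -1 * (x e == 0)%:R)); last first.
    by move=> e /negPf ->; rewrite mulN1r.
  rewrite big_split /= prodr_const; congr (_ * _).
    by congr (_ ^+ _); rewrite -(cardC (mem A)) addKn; apply: eq_card.
  have [/forall_inP x0|] := boolP [forall (e | e \notin A), x e == 0].
    by rewrite big1 // => e /x0 ->.
  by case/forall_inPn => e eA xe; rewrite (bigD1 e) //= (negPf xe) mul0r.
case: ifPn => [/forallP x0|/forallPn[e]].
  by rewrite big1 // => e _; rewrite (negPf (x0 e)) subr0.
by rewrite negbK => xe; rewrite (bigD1 e) //= xe subrr mul0r.
Qed.

End Field.
End FlowCount.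

(** * Edge colourings of regular bipartite multigraphs *)
Section Koenig.
Local Open Scope nat_scope.
Variables (E U V : finType) (s : E -> U) (t : E -> V).
Implicit Types (B M : {set E}) (X D : {set U}).

Lemma card_fibers (T : finType) (f : E -> T) B (X : {set T}) :
  #|[set e in B | f e \in X]| = \sum_(u in X) #|[set e in B | f e == u]|.
Proof.
rewrite -sum1_card (partition_big f (mem X)) /=; last by move=> e;
  rewrite inE => /andP[].
apply: eq_bigr => u uX; rewrite -sum1_card; apply: eq_bigl => e; rewrite !inE.
by rewrite -andbA; case: eqP => [->|]; rewrite ?uX ?andbF.
Qed.

Definition nbrs B X : {set V} := [set t e | e in [set e in B | s e \in X]].

(** Hall's condition for the vertices in [D], when only the edges in [B] may be
    used. *)
Definition hall D B :=
  [forall X : {set U}, (X \subset D) ==> (#|X| <= #|nbrs B X|)].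

(** Rado's argument: take a minimal set [M] of edges that satisfies Hall's
    condition.  If two edges of [M] met at the same left vertex, the removal of
    either would create a violating set, and the submodularity of neighbourhoods
    would make the union or the intersection of these sets violate the condition
    for [M] itself. *)
Lemma hall_matching D B : hall D B ->
  exists2 M : {set E}, M \subset B &
    (forall u, u \in D -> exists2 e, e \in M & s e = u) /\
    (forall e e', e \in M -> e' \in M -> s e \in D -> s e' \in D ->
       s e = s e' \/ t e = t e' -> e = e').
Proof.
move=> hB; have [M /minsetP[hM minM] MB] := minset_exists (P := hall D) hB.
have hall_le X : X \subset D -> #|X| <= #|nbrs M X|.
  by move=> XD; have /forallP/(_ X) := hM; rewrite XD.
have sinj e1 e2 : e1 \in M -> e2 \in M -> s e1 \in D -> s e1 = s e2 -> e1 = e2.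
  move=> M1 M2 sD s12; apply/eqP/contraT => ne.
  (* By minimality, some set violates the condition once [e] is removed; it
     contains the end of [e], since otherwise nothing would have changed. *)
  have viol e : e \in M ->
    exists X, [/\ X \subset D, s e \in X & #|nbrs (M :\ e) X| < #|X|].
    move=> Me; have : ~~ hall D (M :\ e).
      by apply/negP => /minM/(_ (subsetDl _ _)) EM; move: Me;
        rewrite -EM !inE eqxx.
    case/forallPn => X; rewrite negb_imply -ltnNge => /andP[XD lt].
    exists X; split=> //; apply: contraLR lt => sX; rewrite -leqNgt.
    apply: leq_trans (hall_le X XD) (subset_leq_card _).
    apply/subsetP => v /imsetP[e']; rewrite !inE => /andP[Me' sX'] ->.
    apply: imset_f; rewrite !inE Me' sX' !andbT.
    by apply: contraNneq sX => <-.
  have [X1 [XD1 sX1 lt1]] := viol _ M1; have [X2 [XD2 sX2 lt2]] := viol _ M2.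
  (* An edge of [M] at the intersection, away from the common end, differs from
     both [e1] and [e2], so it survives both removals. *)
  have leU := hall_le (X1 :|: X2) ltac:(by rewrite subUset XD1).
  have leI := hall_le ((X1 :&: X2) :\ s e1)
    ltac:(by rewrite (subset_trans (subsetDl _ _)) //
      (subset_trans (subsetIl _ _))).
  have subU : nbrs M (X1 :|: X2) \subset
      nbrs (M :\ e1) X1 :|: nbrs (M :\ e2) X2.
    apply/subsetP => v /imsetP[e]; rewrite !inE => /andP[Me sX] ->.
    have in1 : e != e1 -> s e \in X1 -> t e \in nbrs (M :\ e1) X1.
      by move=> ne1 sXe; apply: imset_f; rewrite !inE ne1 Me.
    have in2 : e != e2 -> s e \in X2 -> t e \in nbrs (M :\ e2) X2.
      by move=> ne2 sXe; apply: imset_f; rewrite !inE ne2 Me.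
    have [ee1|ne1] := eqVneq e e1.
      by apply/orP; right; apply: in2; rewrite ee1 // s12.
    have [ee2|ne2] := eqVneq e e2.
      by apply/orP; left; apply: in1 => //; rewrite ee2 -s12.
    by case/orP: sX => sXe; apply/orP; [left; apply: in1 | right; apply: in2].
  have subI : nbrs M ((X1 :&: X2) :\ s e1) \subset
      nbrs (M :\ e1) X1 :&: nbrs (M :\ e2) X2.
    apply/subsetP => v /imsetP[e];
      rewrite !inE => /andP[Me /and3P[nse sXe1 sXe2]] ->.
    apply/andP; split; apply: imset_f; rewrite !inE Me ?sXe1 ?sXe2 !andbT.
      by apply: contraNneq nse => ->.
    by apply: contraNneq nse => ->; rewrite s12.
  have sI : s e1 \in X1 :&: X2 by rewrite inE sX1 s12 sX2.
  have := cardsD1 (s e1) (X1 :&: X2); rewrite sI => cI.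
  have cX := cardsUI X1 X2.
  have cN := cardsUI (nbrs (M :\ e1) X1) (nbrs (M :\ e2) X2).
  have := subset_leq_card subU; have := subset_leq_card subI.
  by clear -leU leI cI cX cN lt1 lt2; lia.
exists M => //; split=> [u uD|e e' Me Me' sD sD'].
  have := hall_le [set u] ltac:(by rewrite sub1set);
    rewrite cards1 => /card_gt0P[v].
  by case/imsetP => e; rewrite !inE => /andP[Me /eqP su] _; exists e.
case=> [ss|tt]; first exact: sinj.
have [|ns] := eqVneq (s e) (s e'); first exact: sinj.
have := hall_le [set s e; s e'] ltac:(by rewrite subUset !sub1set sD).
rewrite cards2 ns leqNgt ltnS => /negP[].
rewrite -[nat_of_bool _]/1 -(cards1 (t e));
  apply/subset_leq_card/subsetP => v /imsetP[f].
rewrite !inE => /andP[Mf /orP[] /eqP sf] ->.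
  by rewrite (sinj f e) // sf.
by rewrite (sinj f e') ?tt // sf.
Qed.

(** Regularity at the vertices that meet [B], so that removing a perfect matching
    from [B] preserves it with [k] lowered by one. *)
Definition regular k B := forall e, e \in B ->
  #|[set e' in B | s e' == s e]| = k /\ #|[set e' in B | t e' == t e]| = k.

Lemma card_regular (T : finType) (f : E -> T) B k (X : {set T}) :
    (forall e, e \in B -> #|[set e' in B | f e' == f e]| = k) ->
    X \subset f @: B ->
  #|[set e in B | f e \in X]| = #|X| * k.
Proof.
move=> reg XB; rewrite card_fibers -sum_nat_const; apply: eq_bigr => u uX.
by have /imsetP[e eB ->] := subsetP XB u uX; apply: reg.
Qed.

Lemma regular_matching k B : regular k.+1 B ->
  exists2 M : {set E}, M \subset B & forall e, e \in B ->
    #|[set e' in M | s e' == s e]| = 1 /\ #|[set e' in M | t e' == t e]| = 1.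
Proof.
move=> reg; have regs e eB := (reg e eB).1; have regt e eB := (reg e eB).2.
have hB : hall (s @: B) B.
  apply/forallP => X; apply/implyP => XB; rewrite -(leq_pmul2r (ltn0Sn k)).
  rewrite -(card_regular regs XB) -(card_regular regt); last first.
    by apply: imsetS; apply/subsetP => e; rewrite inE => /andP[].
  apply/subset_leq_card/subsetP => e; rewrite !inE => /andP[eB sX].
  by rewrite eB; apply: imset_f; rewrite inE eB.
have [M MB [surj inj]] := hall_matching hB.
have sB e : e \in M -> s e \in s @: B by move=> eM; apply/imset_f/(subsetP MB).
have injM e e' : e \in M -> e' \in M -> s e = s e' \/ t e = t e' -> e = e'.
  by move=> eM e'M; apply: inj => //; apply: sB.
have sM : s @: M = s @: B.
  apply/eqP; rewrite eqEsubset imsetS //=; apply/subsetP => u /surj[e eM <-].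
  exact: imset_f.
have cst : #|s @: B| = #|t @: B|.
  apply/eqP; rewrite -(eqn_pmul2r (ltn0Sn k)).
  rewrite -(card_regular regs (subxx _)) -(card_regular regt (subxx _)).
  apply/eqP/eq_card => e; rewrite !inE; case eB: (e \in B) => //=.
  by rewrite !imset_f.
have tM : t @: M = t @: B.
  apply/eqP; rewrite eqEcard imsetS //= -cst -sM !card_in_imset //.
    by move=> e e' eM e'M tt; apply: injM => //; right.
  by move=> e e' eM e'M ss; apply: injM => //; left.
have one (T : finType) (f : E -> T) e0 : {in M &, injective f} ->
    f e0 \in f @: M -> #|[set e' in M | f e' == f e0]| = 1.
  move=> fi /imsetP[e eM fe]; apply/eqP/cards1P; exists e; apply/setP => e'.
  rewrite !inE; apply/andP/eqP => [[e'M /eqP]|->]; last by rewrite eM fe.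
  by rewrite fe; apply: fi.
exists M => // e eB; split; apply: one.
- by move=> e1 e2 M1 M2 ss; apply: injM => //; left.
- by rewrite sM imset_f.
- by move=> e1 e2 M1 M2 ss; apply: injM => //; right.
- by rewrite tM imset_f.
Qed.

(** Perfect matchings are removed one at a time. *)
Lemma koenig k B : regular k B ->
  exists f : E -> nat, (forall e, e \in B -> f e < k) /\
    forall e e', e \in B -> e' \in B -> s e = s e' \/ t e = t e' ->
      f e = f e' -> e = e'.
Proof.
elim: k B => [|k IHk] B reg.
  have B0 e : e \notin B.
    apply/negP => eB; have [/eqP + _] := reg e eB;
      rewrite cards_eq0 => /eqP/setP/(_ e).
    by rewrite !inE eB eqxx.
  by exists (fun=> 0); split=> [e|e e'] eB; have := B0 e; rewrite eB.
have [M MB match1] := regular_matching reg.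
have fib (T : finType) (f : E -> T) e : #|[set e' in B | f e' == f e]| = k.+1 ->
    #|[set e' in M | f e' == f e]| = 1 ->
      #|[set e' in B :\: M | f e' == f e]| = k.
  move=> cB cM; have -> : [set e' in B :\: M | f e' == f e] =
      [set e' in B | f e' == f e] :\: [set e' in M | f e' == f e].
    by apply/setP => e'; rewrite !inE; case: (e' \in M); case: (e' \in B);
      case: eqP.
  rewrite cardsD (setIidPr _) ?cB ?cM ?subn1 //.
  by apply/subsetP => e'; rewrite !inE => /andP[/(subsetP MB) -> ->].
have [|f [fk finj]] := IHk (B :\: M).
  move=> e; rewrite inE => /andP[_ eB]; have [r1 r2] := reg e eB.
  by have [m1 m2] := match1 e eB; split; apply: fib.
exists (fun e => if e \in M then k else f e); split=> [e eB|e e' eB e'B st].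
  by case: ifPn => // eM; rewrite ltnS ltnW // fk // inE eM.
have [m1 m2] := match1 e eB.
case: ifPn => eM; case: ifPn => e'M.
- have uq (T : finType) (h : E -> T) : #|[set e' in M | h e' == h e]| = 1 ->
     h e = h e' -> e = e'.
    move=> /eqP/cards1P[e0 /setP E0] hh; have := E0 e; have := E0 e'.
    by rewrite !inE eM e'M hh !eqxx => /esym/eqP -> /esym/eqP ->.
  by move=> _; case: st; apply: uq.
- by move=> kf; have := fk e'; rewrite inE e'M e'B -kf ltnn => /(_ isT).
- by move=> kf; have := fk e; rewrite inE eM eB kf ltnn => /(_ isT).
- by apply: finj => //; rewrite inE ?eM ?e'M ?eB.
Qed.

End Koenig.

(** * Flows over small fields and 3-edge-colourings *)
Section Colourings.
Variable G : multigraph.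
Hypothesis hG : cubic G.
Notation dart := (edge G * bool)%type.
Implicit Types (v : vert G) (e : edge G) (d : dart).

Lemma size_star3 v : size (star v) = 3%N.
Proof. by rewrite size_star hG. Qed.

Lemma incidentP e v : reflect (exists2 d, d \in star v & d.1 = e)
  (incident e v).
Proof.
apply: (iffP idP) => [/orP[] inc|[[e' o]]].
- by exists (e, true) => //; rewrite mem_star.
- by exists (e, false) => //; rewrite mem_star.
by rewrite mem_star /incident => /= + <-; case: o => /= ->; rewrite ?orbT.
Qed.

Lemma star_third v d1 d2 : d1 \in star v -> d2 \in star v -> d1.1 != d2.1 ->
  exists d3, perm_eq (star v) [:: d1; d2; d3].
Proof.
move=> d1v d2v ne; apply: size3_rem => //; first exact: size_star3.
by apply: contraNneq ne => ->.
Qed.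

Lemma colorable3 (f : edge G -> nat) :
    (forall e, f e < 3)%N ->
    (forall v d1 d2, d1 \in star v -> d2 \in star v -> d1.1 != d2.1 ->
       f d1.1 != f d2.1) ->
  edge_colorable G 3.
Proof.
move=> f3 fd; apply/existsP; exists [ffun e => inord (f e)].
apply/forallP => e1; apply/forallP => e2; apply/implyP => ne; apply/implyP.
case/existsP=> v /andP[/incidentP[d1 d1v E1] /incidentP[d2 d2v E2]]; subst.
by rewrite !ffunE -val_eqE /= !inordK // (fd v).
Qed.

Lemma colorable_tait : tait (stars G) != 0 -> edge_colorable G 3.
Proof.
move=> t0; case: (pickP
  (fun c : {ffun edge G -> 'I_3} => wts (stars G) (c \o fst) != 0)).
  move=> c w0; apply: (@colorable3 (fun e => c e)) => [e|v d1 d2 d1v d2v ne].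
    exact: ltn_ord.
  have : wt (map (c \o fst) (star v)) != 0.
    apply: contraNneq w0 => wv; rewrite /wts /stars big_map big_enum /=.
    by rewrite (bigD1 v) //= wv mul0r.
  have [d3 p] := star_third d1v d2v ne; have [sg _ Esg] := wt_perm p.
  apply: contraNneq => /val_inj c12; move: (Esg (c \o fst)) => /=; rewrite c12.
  have -> : eps (c d2.1) (c d2.1) (c d3.1) = 0.
    by rewrite /eps subrr mulr0 !mul0r.
  rewrite perm_sym in p; have [sg' _ Esg'] := wt_perm p.
  by move=> _; rewrite Esg' /= c12 /eps subrr mulr0 !mul0r mulr0.
move=> w0; case/eqP: t0; apply: big1 => c _.
by have := w0 c; rewrite /= => /negbFE/eqP.
Qed.

(** In characteristic 2, two equal values at a vertex would force the third to
    vanish; the three nonzero elements of [K] serve as colours. *)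
Lemma colorable_F4 (K : finFieldType) (x : {ffun edge G -> K}) :
  2%N \in [pchar K] -> #|K| = 4%N -> nz_flow x -> edge_colorable G 3.
Proof.
move=> K2 K4 /andP[/forallP x0 /forallP fx].
pose nz := enum [pred y : K | y != 0].
have nz3 : size nz = 3%N.
  by rewrite -cardE -[3%N]/(4.-1)%N -K4 -(cardC1 (0 : K)); apply: eq_card.
apply: (@colorable3 (fun e => index (x e) nz)) => [e|v d1 d2 d1v d2v ne].
  by rewrite -nz3 index_mem mem_enum inE x0.
have [d3 p] := star_third d1v d2v ne.
apply/eqP => /(congr1 (nth 0 nz));
  rewrite !nth_index ?mem_enum ?inE ?x0 // => x12.
have := fx v; rewrite (excess_perm _ p) /excess !big_cons big_nil.
have sg (o : bool) : (-1) ^+ o = 1 :> K.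
  by case: o; rewrite /= ?expr0 // ?expr1 (oppr_pchar2 K2).
by rewrite !sg !mul1r x12 addrA (addrr_pchar2 K2) add0r addr0 (negPf (x0 _)).
Qed.

(** All values are 1, and the degree is odd. *)
Lemma no_F2_flow (x : {ffun edge G -> 'F_2}) v : ~~ nz_flow x.
Proof.
apply/negP => /andP[/forallP x0 /forallP /(_ v)].
have one y : y != 0 -> y = 1 :> 'F_2 by case: y => [[|[|//]] ?] // _;
  apply: val_inj.
have : all (fun d => (-1) ^+ d.2 * x d.1 == 1) (star v).
  by apply/allP => d _; rewrite (one (x _)) // mulr1; case: d.2.
case: (star v) (size_star3 v) => [|a [|b [|c []]]] //= _.
case/and4P => /eqP a1 /eqP b1 /eqP c1 _.
by rewrite /excess !big_cons big_nil a1 b1 c1.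
Qed.

Section F3.
Variable x : {ffun edge G -> 'F_3}.
Hypothesis nzx : nz_flow x.

(** Whether the flow carries the value 1, rather than -1, out of the vertex of
    [d]. *)
Definition outward d : bool := (x d.1 == 1) (+) d.2.

Lemma outward_val d : (-1) ^+ d.2 * x d.1 = if outward d then 1 else -1.
Proof.
have /andP[/forallP /(_ d.1) x0 _] := nzx; rewrite /outward.
by case: d.2 (x d.1) x0 => -[[|[|[|//]]] ?] //= _; apply: val_inj.
Qed.

(** In F_3, three signs add up to zero only if they are equal.  So every vertex is
    a source or a sink, and the graph is bipartite. *)
Lemma outward_star v d1 d2 : d1 \in star v -> d2 \in star v ->
  outward d1 = outward d2.
Proof.
move=> d1v d2v; apply/eqP/contraT => ne.
have d12 : d2 != d1 by apply: contraNneq ne => ->.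
have [d3 p] := size3_rem (size_star3 v) d1v d2v d12.
have /andP[_ /forallP /(_ v)] := nzx.
rewrite (excess_perm _ p) /excess !big_cons big_nil !outward_val.
by move: ne; case: (outward d1); case: (outward d2); case: (outward d3).
Qed.

(** The half-edge of [e] at its source if [b] is false, at its sink otherwise. *)
Definition half_edge (b : bool) e : dart := (e, (x e != 1) (+) b).

Lemma outward_half_edge b e : outward (half_edge b e) = ~~ b.
Proof. by rewrite /outward /half_edge /=; case: (x e == 1); case: b. Qed.

Lemma half_edge_outward b d : outward d = ~~ b -> half_edge b d.1 = d.
Proof.
case: d => e o; rewrite /outward /half_edge /=.
by case: (x e == 1); case: b; case: o.
Qed.

Lemma half_edge_regular b e :
  #|[set e' in [set: edge G] |
      endpt (half_edge b e') == endpt (half_edge b e)]| = 3%N.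
Proof.
rewrite -(size_star3 (endpt (half_edge b e))) -cardE.
rewrite -(card_imset (f := half_edge b)); last first.
  by move=> e1 e2 [].
apply: eq_card => d; rewrite inE; apply/imsetP/eqP => [[e']|dv].
  by rewrite !inE => /eqP <- ->.
have od : outward d = ~~ b.
  by rewrite -(outward_half_edge b e); apply: (@outward_star (endpt d));
    rewrite mem_star ?dv.
by exists d.1; rewrite ?inE ?half_edge_outward ?dv ?eqxx.
Qed.

Lemma colorable_F3 : edge_colorable G 3.
Proof.
have [|f [f3 fne]] := @koenig _ _ _ (fun e => endpt (half_edge false e))
    (fun e => endpt (half_edge true e)) 3 [set: edge G].
  by move=> e _; split; apply: half_edge_regular.
apply: (@colorable3 f) => [e|v d1 d2 d1v d2v]; first by rewrite f3 ?inE.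
apply: contraNneq => f12; apply/eqP; apply: fne; rewrite ?inE //.
have o12 := outward_star d1v d2v.
move: d1v d2v; rewrite !mem_star => /eqP e1 /eqP e2.
case o1: (outward d1); [left|right];
  rewrite !half_edge_outward -?o12 ?o1 ?e1 ?e2 //.
Qed.

End F3.

End Colourings.

(** * Values of the flow polynomial *)
Lemma flow_poly_root1 (G : multigraph) : edge G -> (flow_poly G).[1] = 0.
Proof.
move=> e0; rewrite /flow_poly horner_sum.
transitivity (\prod_(e : edge G) (1 + -1 : int));
  last by rewrite (bigD1 e0) //= subrr mul0r.
rewrite bigA_distr; apply: eq_big => // A _.
rewrite hornerM hornerXn expr1n mulr1 -[-1]/(- 1%:P) -polyCN -polyC_exp hornerC.
rewrite (bigID (mem A)) /= big1 ?mul1r; last by move=> e ->.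
rewrite (eq_bigr (fun=> -1)); last by move=> e /negPf ->.
by rewrite prodr_const; congr (_ ^+ _); rewrite -(cardC (mem A)) addKn;
  apply: eq_card.
Qed.

Lemma flow_poly_root (G : multigraph) (K : finFieldType) :
  (forall x : {ffun edge G -> K}, ~~ nz_flow x) -> (flow_poly G).[#|K|%:R] = 0.
Proof.
move=> no; rewrite flow_poly_count (_ : [set x | _] = set0) ?cards0 //.
by apply/setP => x; rewrite !inE (negPf (no x)).
Qed.

Lemma value0_dvd24 (p : {poly int}) :
  p.[1] = 0 -> p.[2%:R] = 0 -> p.[3%:R] = 0 -> p.[4%:R] = 0 -> (24 %| p.[0])%Z.
Proof.
have div (r : {poly int}) a : r.[a] = 0 ->
  exists q, forall x, r.[x] = q.[x] * (x - a).
  by move=> /eqP/factor_theorem[q ->]; exists q => x; rewrite !hornerE.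
move=> /div[q1 E1]; rewrite !E1 => /eqP;
  rewrite mulf_eq0 orbF => /eqP/div[q2 E2].
rewrite !E2 => /eqP; rewrite !mulf_eq0 !orbF => /eqP/div[q3 E3].
rewrite !E3 => /eqP; rewrite !mulf_eq0 !orbF => /eqP/div[q4 E4].
have prod24 (z : int) :
    z * (0 - 4%:R) * (0 - 3%:R) * (0 - 2%:R) * (0 - 1) = z * 24%:Z by lia.
rewrite E4 prod24.
exact: dvdz_mull.
Qed.

Lemma flow_poly0_F5 (G : multigraph) :
  ((flow_poly G).[0])%:~R = nflow (stars G) :> 'F_5.
Proof.
have h5 : #|'F_5|%:R = 0 :> 'F_5 by rewrite card_Fp // pchar_Fp_0.
have -> : ((flow_poly G).[0])%:~R = ((flow_poly G).[#|'F_5|%:R])%:~R :> 'F_5.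
  by rewrite -!horner_map /= rmorph0 rmorph_nat h5.
rewrite flow_poly_count rmorph_nat -sum1_card natr_sum /nflow big_mkcond /=.
apply: eq_bigr => x _; rewrite inE /nz_flow /flow /stars big_map big_enum /=.
case: ifPn => [/andP[/forallP x0 /forallP fx]|].
  by rewrite !big1 ?mul1r // => [v|e] _; rewrite ?fx ?x0.
rewrite negb_and => /orP[] /forallPn[i ni];
  rewrite (bigD1 i) //= (negPf ni) ?mul0r //.
by rewrite mulr0.
Qed.

Lemma mod5_F5 (z : int) (n : nat) : z%:~R = n%:R :> 'F_5 -> (z = n %[mod 5])%Z.
Proof.
move=> zn; apply/eqP; rewrite eqz_mod_dvd dvdzE /=.
have p5 : 5%N \in [pchar 'F_5] by apply: pchar_Fp.
rewrite (dvdn_pcharf p5).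
have z0 : (z - n%:Z)%:~R = 0 :> 'F_5 by rewrite rmorphB /= zn subrr.
move: (z - _) z0 => [m|m] /eqP //=.
by rewrite NegzE rmorphN oppr_eq0.
Qed.

Theorem theorem1p2 (G : multigraph) (hG : cubic G) :
  let F0 : int := (flow_poly G).[0] in
  [/\ ~~ odd (#|vert G| %/ 2) ->
        [\/ (F0 = 0 %[mod 5])%Z, (F0 = 1 %[mod 5])%Z | (F0 = 4 %[mod 5])%Z],
      odd (#|vert G| %/ 2) ->
        [\/ (F0 = 0 %[mod 5])%Z, (F0 = 2 %[mod 5])%Z | (F0 = 3 %[mod 5])%Z]
    & snark G -> (F0 = 0 %[mod 5])%Z /\ (120 %| F0)%Z].
Proof.
move=> F0.
have F0E : F0%:~R = 2%:R ^+ (#|vert G|./2) * tait (stars G) ^+ 2 :> 'F_5.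
  have sub : subcubic (stars G).
    rewrite /subcubic perm_stars; apply/allP => l /mapP[v _ ->].
    by rewrite size_star3.
  have ncubicE : ncubic (stars G) = #|vert G|.
    rewrite /ncubic /stars count_map cardE -(count_predT (enum _));
      apply: eq_count => v.
    by rewrite /= size_star3.
  by rewrite flow_poly0_F5 -ncubicE -/(tait_square _); apply/eqP;
    rewrite -subr_eq0 -/(gap _) (gap_eq0 sub).
(* A power of 2 is 1 or 2 up to sign, according to the parity of the exponent,
   and [t] ranges over the five elements of the field. *)
have cases :
    exists2 n : nat, F0%:~R = n%:R :> 'F_5 &
      n \in (if odd (#|vert G| %/ 2) then [:: 0; 2; 3] else [:: 0; 1; 4])%N.
  rewrite divn2 F0E; set k := #|vert G|./2; move: (tait _) => t.
  have -> : 2%:R ^+ k = 2%:R ^+ odd k * (-1) ^+ odd k./2 :> 'F_5.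
    rewrite signr_odd -[in LHS](odd_double_half k) exprD -mul2n exprM.
    by congr (_ * _ ^+ _); apply/eqP.
  exists (nat_of_ord (2%:R ^+ odd k * (-1) ^+ odd k./2 * t ^+ 2 : 'F_5)).
    by rewrite natr_Zp.
  by case: (odd k) (odd k./2) t => [] [] -[[|[|[|[|[|//]]]]] ?].
have [n /mod5_F5 F0n nin] := cases.
split.
- move=> /negPf ev; move: nin; rewrite ev !inE => /or3P[] /eqP En;
  rewrite En in F0n.
  + by constructor 1.
  + by constructor 2.
  + by constructor 3.
- move=> ev; move: nin; rewrite ev !inE => /or3P[] /eqP En; rewrite En in F0n.
  + by constructor 1.
  + by constructor 2.
  + by constructor 3.
case=> _ _ chi.
have nocol : ~~ edge_colorable G 3.
  move: chi; rewrite /chromatic_index; case: ex_minnP => m _ minm m4.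
  by apply/negP => /minm; rewrite m4.
have F5 : (F0 = 0 %[mod 5])%Z.
  apply: (@mod5_F5 F0 0); rewrite F0E.
  have -> : tait (stars G) = 0 by apply: contraNeq nocol; apply: colorable_tait.
  by rewrite expr0n mulr0.
split=> //; have [e0 _|noe] := pickP (fun _ : edge G => true); last first.
  case/negP: nocol; apply: (@colorable3 G (fun=> 0%N)) => // v d1.
  by have := noe d1.1.
have d24 : (24 %| F0)%Z.
  apply: value0_dvd24; first exact: flow_poly_root1 e0.
  - have := @flow_poly_root G 'F_2; rewrite card_Fp //; apply=> x.
    exact: (no_F2_flow hG x (ends e0).1).
  - have := @flow_poly_root G 'F_3; rewrite card_Fp //; apply=> x.
    by apply: contra nocol; apply: colorable_F3.
  - have [K K2 K4] := @pPrimePowerField 2 2 isT isT.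
    have := @flow_poly_root G K; rewrite K4; apply=> x.
    by apply: contra nocol; apply: colorable_F4 K2 K4.
have d5 : (5 %| F0)%Z by rewrite -[F0]subr0 -eqz_mod_dvd F5.
by have := @Gauss_dvdz 5 24 F0 isT; rewrite d5 d24; apply.
Qed.
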